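(* Let $F$ be a properly parametrized Markov multi-map of $[0,1]$ with associated shift of finite type $\Sigma_M$ and inverse limit system $(Y,S)$. (1) If $\Sigma_M$ satisfies the Irreducibility Condition (IC) and the Coding Condition (CC), then $(Y,S)$ is Devaney chaotic. (2) If $\Sigma_M$ satisfies the Mixing Condition (MC) and the Coding Condition (CC), then $(Y,S)$ is topologically mixing. (3) If $\Sigma_M$ satisfies the Mixing Condition (MC), with mixing component $\mathcal{C}_0\supset\mathcal{A}^{(e)}$, and the Coding Condition (CC), and if $\{g_u:u\in\mathcal{L}(\mathcal{C}_0)\}$ is uniformly equicontinuous, then $(Y,S)$ has the specification property.
   Context: **Markov multi-maps.** $2^{[0,1]}$ denotes the set of closed subsets of $[0,1]$. A Markov multi-map of $[0,1]$ is given by a tuple $F=(P,\mathcal{A}_0,\mathcal{A}_1,\mathcal{A}_2,D,R,\{f_a\}_{a\in\mathcal{A}_0})$ such that: (1) $P=\{p_0,\dots,p_r\}$ with $0=p_0<\dots<p_r=1$; (2) $\mathcal{A}=\mathcal{A}_0\sqcup\mathcal{A}_1\sqcup\mathcal{A}_2$ is a finite set; (3) $D:\mathcal{A}\to 2^{[0,1]}$, and for each $a\in\mathcal{A}$ there is $p_i\in P$ with $D(a)=[p_i,p_{i+1}]$ if $a\in\mathcal{A}_0$ and $D(a)=\{p_i\}$ if $a\in\mathcal{A}_1\cup\mathcal{A}_2$; (4) $R:\mathcal{A}\to 2^{[0,1]}$, and for each $a\in\mathcal{A}$ there are $u\le v$ in $P$ with $R(a)=[u,v]$, where $u<v$ if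 $a\in\mathcal{A}_0$; $u<v$ and $R(a)\cap P=\{u,v\}$ if $a\in\mathcal{A}_1$; $u=v$ if $a\in\mathcal{A}_2$; (5) for each $a\in\mathcal{A}_0$, $f_a:D(a)\to R(a)$ is a homeomorphism; (6) $[0,1]=\bigcup_{a\in\mathcal{A}}D(a)$. For $a\in\mathcal{A}_0$ let $G(a)$ be the graph of $f_a$; for $a\in\mathcal{A}_1\cup\mathcal{A}_2$ let $G(a)=D(a)\times R(a)$. The multi-map $F:[0,1]\to 2^{[0,1]}$ has graph $G(F)=\bigcup_{a\in\mathcal{A}}G(a)$, i.e. $y\in F(x)$ iff $(x,y)\in G(F)$. If $a\in\mathcal{A}_0$ with $D(a)=[p_i,p_{i+1}]$, $R(a)=[u,v]$: $D_0(a)=(p_i,p_{i+1})$, $R_0(a)=(u,v)$, $G_0(a)$ = graph of $f_a|_{D_0(a)}$. If $a\in\mathcal{A}_1$ with $D(a)=\{p\}$, $R(a)=[u,v]$: $D_0(a)=\{p\}$, $R_0(a)=(u,v)$, $G_0(a)=\{p\}\times(u,v)$. If $a\in\mathcal{A}_2$ with $D(a)=\{p\}$, $R(a)=\{q\}$: $D_0(a)=\{p\}$, $R_0(a)=\{q\}$, $G_0(a)=\{(p,q)\}$. $F$ is properly parametrized if $\{G_0(a):a\in\mathcal{A}\}$ is a partition of $G(F)$. **Trajectories.** $X=\{x\in[0,1]^{\mathbb{Z}_{\ge0}}:x_{k+1}\in F(x_k)\ \forall k\ge0\}$. For $n\ge 1$, $X_n=\{(x_0,\dots,x_{n-1})\in[0,1]^n:(x_i,x_{i+1})\in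 G(F),\ 0\le i\le n-2\}$ with the subspace topology. $Y=\{y\in[0,1]^{\mathbb{Z}_{\le0}}:y_{k+1}\in F(y_k)\ \forall k\le-1\}$ with the subspace topology of the product topology, given by the metric $d(x,y)=\sup_{k\ge0}|x_{-k}-y_{-k}|/(k+1)$, and $S:Y\to Y$, $S(y)_k=y_{k-1}$. **Dynamical properties** of a system $(Z,f)$ ($Z$ compact metric, $f$ continuous). Topologically transitive: for all nonempty open $U,V\subset Z$ there is $n\ge0$ with $f^n(U)\cap V\ne\emptyset$. Devaney chaotic: topologically transitive and the periodic points (those $x$ with $f^p(x)=x$ for some $p\ge1$) are dense. Topologically mixing: for all nonempty open $U,V$ there is $N\ge0$ with $f^n(U)\cap V\neq\emptyset$ for all $n\ge N$. Specification property: for all $\epsilon>0$ there is $N\ge0$ such that for any $x_1,\dots,x_l\in Z$, any positive integers $a_1\le b_1<a_2\le b_2<\cdots<a_l\le b_l$ with $a_{i+1}-b_i\ge N$ for $i=1,\dots,l-1$, and any $p\ge b_l+N$, there is $z\in Z$ with $f^p(z)=z$ and $d(f^i(z),f^i(x_k))<\epsilon$ for all $k=1,\dots,l$ and $a_k\le i\le b_k$. **Associated SFT.** $M(a,b)=1$ if $D_0(b)\subset R_0(a)$ and $M(a,b)=0$ otherwise ($a,b\in\mathcal{A}$). $\Sigma_M=\{\mathbf{a}\in\mathcal{A}^{\mathbb{Z}_{\ge0}}:M(a_n,a_{n+1})=1\ \forall n\ge 0\}$, with left shift $\sigma$. For $Z\subset\Sigma_M$, $\mathcal{L}_n(Z)$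 is the set of words of length $n$ appearing in points of $Z$, $\mathcal{L}(Z)=\bigcup_n\mathcal{L}_n(Z)$; $\mathcal{L}_n=\mathcal{L}_n(\Sigma_M)$, $\mathcal{L}=\mathcal{L}(\Sigma_M)$. For $\mathcal{C}\subset\mathcal{A}$, $\Sigma_M(\mathcal{C})$ is the set of points of $\Sigma_M$ using only symbols of $\mathcal{C}$, $\mathcal{L}_n(\mathcal{C})=\mathcal{L}_n(\Sigma_M(\mathcal{C}))$ and $\mathcal{L}(\mathcal{C})=\mathcal{L}(\Sigma_M(\mathcal{C}))$. A subshift $Z\subset\Sigma_M$ is a closed set with $\sigma(Z)\subset Z$; it is transitive on symbols if for all $a,b\in\mathcal{L}_1(Z)$ some word in $\mathcal{L}(Z)$ starts with $a$ and ends with $b$. **Inverse functions.** For $a\in\mathcal{A}_0$, $g_a=f_a^{-1}$; for $a\in\mathcal{A}_1\cup\mathcal{A}_2$, $g_a:R(a)\to D(a)$ is the constant map. For $u=u_0\cdots u_n\in\mathcal{L}$, $g_u=g_{u_0}\circ\cdots\circ g_{u_n}$ (defined on $R(u_n)$) and $I_u=g_u(R(u_n))$. For a possibly degenerate interval, $\ell([p,q])=q-p$. A family $\{g_\omega:\omega\in\Omega\}$ of functions, $g_\omega$ defined on a compact (possibly degenerate) interval $J_\omega\subset[0,1]$, is uniformly equicontinuous if for every $\epsilon>0$ there is $\delta>0$ such that for all $\omega\in\Omega$ and $x,y\in J_\omega$ with $|x-y|<\delta$, $|g_\omega(x)-g_\omega(y)|<\epsilon$. **Coding Condition (CC).** There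 is a subshift $Z\subset\Sigma_M$, transitive on symbols, such that (i) for every $y\in[0,1]$ there are $\mathbf{a}\in Z$ and $x\in X$ with $x_0=y$ and $(x_i,x_{i+1})\in G(a_i)$ for all $i\ge0$; and (ii) $\lim_{n\to\infty}\max_{u\in\mathcal{L}_n(Z)}\ell(I_u)=0$. **Essential symbols.** A word $u=u_0\cdots u_{n-1}\in\mathcal{L}_n$ is essential if $\{x\in X_{n+1}:(x_k,x_{k+1})\in G_0(u_k),\ 0\le k\le n-1\}$ is open in $X_{n+1}$. A symbol is essential if it appears in some essential word; $\mathcal{A}^{(e)}$ is the set of essential symbols. **(IC) and (MC).** A set $\mathcal{C}\subset\mathcal{A}$ is irreducible if for all $a,b\in\mathcal{C}$ there is a word in $\mathcal{L}(\mathcal{C})$ beginning with $a$ and ending with $b$; it is mixing if there is $N\ge1$ such that for all $a,b\in\mathcal{C}$ and all $n\ge N$ there is a word in $\mathcal{L}_n(\mathcal{C})$ beginning with $a$ and ending with $b$. An irreducible (resp. mixing) component is a maximal irreducible (resp. mixing) subset of $\mathcal{A}$. $\Sigma_M$ satisfies (IC) (resp. (MC)) if there is an irreducible (resp. mixing) component $\mathcal{C}$ with $\mathcal{A}^{(e)}\subset\mathcal{C}$. *)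

(* Defs.v *)
From mathcomp Require Import all_boot all_order all_algebra.
From mathcomp Require Import all_classical all_reals all_analysis.

Set Implicit Arguments.
Unset Strict Implicit.
Unset Printing Implicit Defensive.

Import Order.TTheory GRing.Theory Num.Theory.
Import numFieldNormedType.Exports.

Local Open Scope classical_set_scope.
Local Open Scope ring_scope.

Section Intervals.
Context {R : realType}.
Implicit Types (J A B : set R) (f : R -> R).

Definition unit_interval : set R := `[0, 1]%classic.

(* [open_part [u, v]] is [(u, v)] for u < v *)
Definition open_part J : set R :=
  [set x | exists u v, J = `[u, v]%classic /\ u < x < v].

(* [len [p, q]] is q - p, also when p = q *)
Definition len J : R := sup J - inf J.

(* the inverse B -> A of a bijection f : A -> B; junk outside B *)
Definition inverse_on A f : R -> R := 'pinv_(fun=> 0) A f.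

Definition homeomorphism_on A B f : Prop :=
  [/\ set_bij A B f,
      {within A, continuous f} &
      {within B, continuous (inverse_on A f)}].

End Intervals.

(* [mm_class] below encodes the disjoint union A_0 + A_1 + A_2. *)
Inductive symbol_class := class0 | class1 | class2.

(* The raw tuple: [mm_P] lists p_0, ..., p_r, and only the restrictions of
   [mm_f a] to [mm_D a], for [a] of class 0, are meaningful. *)
Record multimap_data (R : realType) := MultimapData {
  mm_P : seq R;
  mm_A : finType;
  mm_class : mm_A -> symbol_class;
  mm_D : mm_A -> set R;
  mm_R : mm_A -> set R;
  mm_f : mm_A -> R -> R
}.

Record is_markov_multimap (R : realType) (F : multimap_data R) : Prop := {
  mm_P_sorted : sorted <%R (mm_P F);
  mm_P_head : head 1 (mm_P F) = 0;
  mm_P_last : last 0 (mm_P F) = 1;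
  mm_D_spec : forall a : mm_A F,
    match mm_class a with
    | class0 => exists2 i, (i.+1 < size (mm_P F))%N &
                mm_D a = `[(mm_P F)`_i, (mm_P F)`_i.+1]%classic
    | class1 | class2 => exists2 i, (i < size (mm_P F))%N &
                mm_D a = [set (mm_P F)`_i]
    end;
  mm_R_spec : forall a : mm_A F, exists u v : R,
    [/\ u \in mm_P F, v \in mm_P F, u <= v, mm_R a = `[u, v]%classic &
      match mm_class a with
      | class0 => u < v
      | class1 => u < v /\ mm_R a `&` [set` mm_P F] = [set u; v]
      | class2 => u = v
      end];
  mm_f_spec : forall a : mm_A F, mm_class a = class0 ->
    homeomorphism_on (mm_D a) (mm_R a) (mm_f a);
  mm_D_cover : unit_interval = \bigcup_(a in [set: mm_A F]) mm_D a
}.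

Section MultiMap.
Context {R : realType} (F : multimap_data R).
Local Notation A := (mm_A F).
Implicit Types (a b : A) (u : seq A) (C : set A).

Definition graph a : set (R * R) :=
  if mm_class a is class0 then [set xy | mm_D a xy.1 /\ xy.2 = mm_f a xy.1]
  else mm_D a `*` mm_R a.

Definition graphF : set (R * R) := \bigcup_(a in [set: A]) graph a.

Definition multimap (x : R) : set R := [set y | graphF (x, y)].

Definition D0 a : set R :=
  if mm_class a is class0 then open_part (mm_D a) else mm_D a.

Definition R0 a : set R :=
  if mm_class a is class2 then mm_R a else open_part (mm_R a).

Definition graph0 a : set (R * R) :=
  if mm_class a is class0 then [set xy | D0 a xy.1 /\ xy.2 = mm_f a xy.1]
  else D0 a `*` R0 a.

Definition properly_parametrized : Prop :=
  partition [set: A] graph0 graphF.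

Definition traj : set (nat -> R) :=
  [set x | forall k, unit_interval (x k) /\ multimap (x k) (x k.+1)].

Definition fin_traj n : set 'rV[R]_n :=
  [set x | (forall i, unit_interval (x 0 i)) /\
           (forall i j : 'I_n, j = i.+1 :> nat -> graphF (x 0 i, x 0 j))].

(* The coordinate of index -k of a backward trajectory is stored at k. *)
Definition back_traj : set {ptws nat -> R} :=
  [set y | forall k, unit_interval (y k) /\ multimap (y k.+1) (y k)].

Definition backY : topologicalType := set_type back_traj.

Definition Ydist (x y : backY) : R :=
  sup (range (fun k : nat => `|set_val x k - set_val y k| / k.+1%:R)).

Lemma back_traj_shift (y : nat -> R) :
  back_traj y -> back_traj (fun k => y k.+1).
Proof. by move=> yY k; exact: yY. Qed.

Definition shiftY (y : backY) : backY :=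
  SigSub (mem_set (back_traj_shift (set_valP y))).

Definition transition a b : bool := `[< D0 b `<=` R0 a >].

Definition SigmaM : set (nat -> A) :=
  [set s | forall n, transition (s n) (s n.+1)].

Definition SigmaM_in C : set (nat -> A) :=
  SigmaM `&` [set s | forall n, C (s n)].

Definition lang_n (Z : set (nat -> A)) n : set (seq A) :=
  [set u | exists s k, Z s /\ u = mkseq (fun i => s (k + i)%N) n].

Definition lang (Z : set (nat -> A)) : set (seq A) :=
  \bigcup_(n in [set: nat]) lang_n Z n.

Definition begins_ends a b u : Prop :=
  exists2 v, u = a :: v & last a v = b.

Definition subshift (Z : set (nat -> A)) : Prop :=
  [/\ Z `<=` SigmaM,
      closed (Z : set {ptws nat -> discrete_topology A}) &
      forall s, Z s -> Z (fun n => s n.+1)].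

Definition transitive_on_symbols (Z : set (nat -> A)) : Prop :=
  forall a b, lang_n Z 1 [:: a] -> lang_n Z 1 [:: b] ->
    exists2 u, lang Z u & begins_ends a b u.

Definition ginv a : R -> R :=
  if mm_class a is class0 then inverse_on (mm_D a) (mm_f a)
  else cst (get (mm_D a)).

Definition ginv_word u : R -> R := foldr (fun a h => ginv a \o h) id u.

(* the domain R(u_n) of [ginv_word (u_0 ... u_n)]; for the empty word, whose
   [ginv_word] is the identity, this is [0, 1] *)
Definition word_dom u : set R :=
  if u is a :: v then mm_R (last a v) else unit_interval.

Definition Iword u : set R := ginv_word u @` word_dom u.

Definition coding_condition : Prop :=
  exists Z : set (nat -> A),
    [/\ subshift Z, transitive_on_symbols Z,
        (forall y, unit_interval y -> exists s x,
           [/\ Z s, traj x, x 0%N = y & forall i, graph (s i) (x i, x i.+1)]) &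
        (fun n => \big[Num.max/0]_(u : n.-tuple A | (u : seq A) \in lang_n Z n)
                    len (Iword u)) @ \oo --> (0 : R)].

(* x_k and x_(k+1), for x in X_(n+1), are read at the images of k : 'I_n under
   [widen_ord] and [lift ord0] *)
Definition essential_word n (u : n.-tuple A) : Prop :=
  lang_n SigmaM n u /\
  open ([set x | fin_traj x /\ forall k : 'I_n,
           graph0 (tnth u k) (x 0 (widen_ord (leqnSn n) k), x 0 (lift ord0 k))]
        : set (subspace (@fin_traj n.+1))).

Definition essential_symbols : set A :=
  [set a | exists n (u : n.-tuple A), essential_word u /\ a \in u].

Definition irreducible C : Prop :=
  forall a b, C a -> C b ->
    exists2 u, lang (SigmaM_in C) u & begins_ends a b u.

Definition mixing C : Prop :=
  exists2 N, (1 <= N)%N & forall a b, C a -> C b -> forall n, (N <= n)%N ->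
    exists2 u, lang_n (SigmaM_in C) n u & begins_ends a b u.

Definition maximal_set (Q : set A -> Prop) C : Prop :=
  Q C /\ forall C', Q C' -> C `<=` C' -> C' = C.

Definition irreducible_component := maximal_set irreducible.
Definition mixing_component := maximal_set mixing.

Definition irreducibility_condition : Prop :=
  exists2 C, irreducible_component C & essential_symbols `<=` C.

Definition mixing_condition : Prop :=
  exists2 C, mixing_component C & essential_symbols `<=` C.

End MultiMap.

Definition uniformly_equicontinuous (R : realType) (I : Type) (W : set I)
    (J : I -> set R) (g : I -> R -> R) : Prop :=
  forall e, 0 < e -> exists2 d, 0 < d & forall w, W w ->
    forall x y, J w x -> J w y -> `|x - y| < d -> `|g w x - g w y| < e.

Section Dynamics.
Context {Z : topologicalType} (f : Z -> Z).

Definition topologically_transitive : Prop :=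
  forall U V : set Z, open U -> open V -> U !=set0 -> V !=set0 ->
    exists n, (iter n f @` U) `&` V !=set0.

Definition periodic_points : set Z :=
  [set x | exists2 p, (1 <= p)%N & iter p f x = x].

Definition devaney_chaotic : Prop :=
  topologically_transitive /\ dense periodic_points.

Definition topologically_mixing : Prop :=
  forall U V : set Z, open U -> open V -> U !=set0 -> V !=set0 ->
    exists N, forall n, (N <= n)%N -> (iter n f @` U) `&` V !=set0.

End Dynamics.

(* The l + 1 points and time intervals are indexed by 'I_l.+1, from 0. *)
Definition specification (R : realType) (Z : Type) (d : Z -> Z -> R)
    (f : Z -> Z) : Prop :=
  forall e, 0 < e -> exists N : nat,
    forall (l : nat) (x : 'I_l.+1 -> Z) (a b : 'I_l.+1 -> nat) (p : nat),
      (forall k, (0 < a k <= b k)%N) ->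
      (forall i j : 'I_l.+1, j = i.+1 :> nat ->
         (b i < a j)%N /\ (N <= a j - b i)%N) ->
      (b ord_max + N <= p)%N ->
      exists2 z, iter p f z = z &
        forall (k : 'I_l.+1) (i : nat), (a k <= i <= b k)%N ->
          d (iter i f z) (iter i f (x k)) < e.

(* Main.v *)
Require Import Defs.
From mathcomp Require Import all_boot all_order all_algebra.
From mathcomp Require Import all_classical all_reals all_analysis.
From mathcomp Require Import lra zify.

(** Code a backward trajectory by the symbols of its edges.  A trajectory coded
    by a finite admissible word is the image of its last point t under the maps
    g_u of the suffixes u, so the trajectories with a given code form an arc
    (last symbol of class 0 or 1) or a single point (class 2).  Arcs are open
    among all trajectories of their length, hence essential, and a point which
    is not open is a limit of arcs: trajectories coded by essential symbols are
    dense.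

    Given such a trajectory with last point t, the Coding Condition forces any
    continuation with a suitable code to start near t: move t slightly inside
    its arc, off the finitely many points whose orbit meets P within n steps;
    the next n symbols of its itinerary in Z then have class 0, so they are
    essential, and I_u is short for the word u they form.  By continuity of the
    g_u (uniformly in the length, if they are equicontinuous) every trajectory
    with the extended code shadows the given one.

    Irreducibility or mixing joins several such codes into a periodic code, and
    g_u for its period u is a continuous self-map of the interval R(u_n), whose
    fixed point gives a periodic point of S. *)

Set Implicit Arguments.
Unset Strict Implicit.
Unset Printing Implicit Defensive.

Import Order.TTheory GRing.Theory Num.Theory.
Import numFieldNormedType.Exports.

Local Open Scope classical_set_scope.
Local Open Scope ring_scope.

(** * Continuity on a set and intervals *)


Section ContinuityOn.
Context {R : realType}.
Implicit Types (J K : set R) (f g : R -> R) (x y : R).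

(** Epsilon-delta form of continuity within [J], convenient for composing maps between changing
    intervals. *)
Definition cont_on J g := forall x e, J x -> 0 < e -> exists2 d, 0 < d &
  forall y, J y -> `|x - y| < d -> `|g x - g y| < e.

Lemma cont_onP J g : cont_on J g <-> {within J, continuous g}.
Proof.
split=> [gJ|].
  apply/subspace_continuousP => x Jx; apply/cvgrPdist_lt => e e0.
  have [d d0 gd] := gJ x e Jx e0.
  by rewrite near_withinE; apply/nbhs_ballP; exists d => // y xy Jy; exact: gd.
move=> /subspace_continuousP gJ x e Jx e0.
move: (gJ x Jx) => /cvgrPdist_lt /(_ e e0); rewrite near_withinE.
move=> /nbhs_ballP[d /= d0 gd]; exists d => // y Jy xy; exact: gd.
Qed.

Lemma cont_on_comp J K f g : (forall x, J x -> K (f x)) ->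
  cont_on K g -> cont_on J f -> cont_on J (g \o f).
Proof.
move=> JK gK fJ x e Jx e0; have [d d0 gd] := gK _ _ (JK _ Jx) e0.
by have [d' d'0 fd] := fJ _ _ Jx d0; exists d' => // y Jy /(fd _ Jy) /gd; apply; exact: JK.
Qed.

(** The intermediate value theorem for [g x - x], which is nonnegative at [u] and nonpositive at
    [v]. *)
Lemma cont_on_fixpoint (u v : R) g : u <= v -> cont_on `[u, v] g ->
  (forall x, `[u, v]%classic x -> `[u, v]%classic (g x)) ->
  exists2 x, `[u, v]%classic x & g x = x.
Proof.
move=> uv gc gJ.
have : {within `[u, v], continuous (fun x => g x - x)}.
  apply/cont_onP => x e Jx e0; have [d d0 gd] := gc x (e / 2) Jx ltac:(by lra).
  exists (Num.min d (e / 2)); first by rewrite lt_min d0; lra.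
  move=> y Jy; rewrite lt_min => /andP[/(gd _ Jy) A B].
  apply: (le_lt_trans (y := `|g x - g y| + `|x - y|)); last by lra.
  rewrite (_ : _ - _ = (g x - g y) - (x - y)); last by lra.
  exact: ler_normB.
move=> /(IVT (v := 0) uv)[].
  have /gJ : `[u, v]%classic u by rewrite /= in_itv /= lexx.
  have /gJ : `[u, v]%classic v by rewrite /= in_itv /= lexx andbT.
  rewrite /= !in_itv /= => /andP[_ gv] /andP[gu _].
  by rewrite ge_min le_max; apply/andP; split; apply/orP; [right|left]; lra.
by move=> x Jx /eqP; rewrite subr_eq0 => /eqP gx; exists x.
Qed.

(** Each interval contains the endpoints of the other. This pins down the endpoints quantified in
    [open_part]. *)
Lemma closed_itv_inj (u v u' v' : R) : u <= v ->
  `[u, v]%classic = `[u', v']%classic -> u' = u /\ v' = v.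
Proof.
move=> uv E.
have : `[u', v']%classic u by rewrite -E /= in_itv /= lexx.
have : `[u', v']%classic v by rewrite -E /= in_itv /= lexx andbT.
rewrite /= !in_itv /= => /andP[u'v vv'] /andP[u'u uv'].
have : `[u, v]%classic u' by rewrite E /= in_itv /= lexx /=; lra.
have : `[u, v]%classic v' by rewrite E /= in_itv /= lexx andbT; lra.
by rewrite /= !in_itv /= => /andP[? ?] /andP[? ?]; lra.
Qed.

Lemma open_part_itv (u v : R) : u <= v -> open_part `[u, v]%classic = `]u, v[%classic.
Proof.
move=> uv; apply/seteqP; split => x /=; rewrite in_itv /=.
  by move=> [u' [v' [/(closed_itv_inj uv) [-> ->]]]].
by move=> ?; exists u, v.
Qed.

(** Induction on [s]: when the next listed point lies inside the interval, only the part to its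
    right is kept. *)
Lemma itv_avoid (u v : R) (s : seq R) : u < v -> exists2 x, u < x < v & x \notin s.
Proof.
elim: s u v => [|q s IH] u v uv; first by exists ((u + v) / 2) => //; lra.
case: (boolP (u < q < v)) => [/andP[uq qv]|nq].
  have [x /andP[qx xv] xs] := IH q v qv; exists x; first by lra.
  by rewrite inE negb_or xs andbT; apply/eqP; lra.
have [x ux xs] := IH u v uv; exists x => //.
by rewrite inE negb_or xs andbT; apply: contra nq => /eqP <-.
Qed.

(** A continuous injection of an interval is strictly monotone; the equality of pairs covers both
    orientations. *)
Lemma bij_itv_endpoints (p q u v : R) f : p < q -> u <= v ->
  {within `[p, q], continuous f} -> set_bij `[p, q] `[u, v] f ->
  [set f p; f q] = [set u; v].
Proof.
move=> pq uv fc [fsub finj fsurj].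
have Ip : `[p, q]%classic p by rewrite /= in_itv /= lexx ltW.
have Iq : `[p, q]%classic q by rewrite /= in_itv /= lexx ltW.
have /fsurj[x Ix fx] : `[u, v]%classic u by rewrite /= in_itv /= lexx.
have /fsurj[y Iy fy] : `[u, v]%classic v by rewrite /= in_itv /= lexx andbT.
have fp : `[u, v]%classic (f p) by exact: fsub.
have fq : `[u, v]%classic (f q) by exact: fsub.
rewrite /= !in_itv /= in fp fq Ix Iy.
have Jp : p \in `[p, q] by exact: Ip.
have Jq : q \in `[p, q] by exact: Iq.
have Jx : x \in `[p, q] by rewrite in_itv.
have Jy : y \in `[p, q] by rewrite in_itv.
have fi : {in `[p, q]%R &, injective f}.
  by move=> a b ? ?; apply: finj; rewrite inE.
have [m|m] := itv_continuous_inj_mono fc fi.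
  have -> : f p = u.
    case: (eqVneq p x) => [->//|px].
    by have := m _ _ Jp Jx ltac:(by rewrite lt_neqAle px; lra); lra.
  have -> // : f q = v.
  case: (eqVneq y q) => [<-//|yq].
  by have := m _ _ Jy Jq ltac:(by rewrite lt_neqAle yq; lra); lra.
rewrite setUC.
have -> : f p = v.
  case: (eqVneq p y) => [->//|px].
  by have := m _ _ Jy Jp ltac:(by rewrite lt_neqAle px; lra); lra.
have -> // : f q = u.
case: (eqVneq x q) => [<-//|yq].
by have := m _ _ Jq Jx ltac:(by rewrite lt_neqAle yq; lra); lra.
Qed.

End ContinuityOn.

(** * Symbols and their graphs *)


Section Structure.
Context {R : realType} (F : multimap_data R).
Hypothesis MF : is_markov_multimap F.
Hypothesis PF : properly_parametrized F.
Local Notation A := (mm_A F).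
Local Notation P := (mm_P F).
Implicit Types (a b c : A) (x y : R).

Lemma partition_point_lt i j : (i < j)%N -> (j < size P)%N -> P`_i < P`_j.
Proof.
move=> ij jP; rewrite lt_sorted_ltn_nth ?inE //; last exact: ltn_trans jP.
exact: mm_P_sorted.
Qed.

Lemma partition_point_unit p : p \in P -> unit_interval p.
Proof.
move=> /(nthP 0)[i iP <-]; rewrite /unit_interval /= in_itv /=.
have P0 : P`_0 = 0.
  by have := mm_P_head MF; case: (P) iP => //= ? ? _ ->.
have P1 : P`_(size P).-1 = 1 by rewrite nth_last; exact: mm_P_last.
apply/andP; split.
  by case: i iP => [|i] iP; [rewrite P0|rewrite -[leLHS]P0; apply/ltW/partition_point_lt].
rewrite -P1; case: (ltngtP i (size P).-1) => [lt|gt|->//].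
  by apply/ltW/partition_point_lt => //; lia.
by exfalso; move: (size P) iP gt => n; lia.
Qed.

Lemma cell_avoids_P i p : (i.+1 < size P)%N -> p \in P -> ~ (P`_i < p < P`_i.+1).
Proof.
move=> iP /(nthP 0)[j jP <-] /andP[].
have S := mm_P_sorted MF; have iP' := ltnW iP.
by rewrite !lt_sorted_ltn_nth ?inE // => ? ?; lia.
Qed.

(** A view merging classes 1 and 2, whose domains are points; [R_shape] instead merges classes 0 and
    1, whose ranges are nondegenerate. *)
Variant D_shape a : Prop :=
| D_cell i of mm_class a = class0 & (i.+1 < size P)%N &
    P`_i < P`_i.+1 & mm_D a = `[P`_i, P`_i.+1]%classic
    & D0 a = `]P`_i, P`_i.+1[%classic
| D_point p of mm_class a <> class0 & p \in P & mm_D a = [set p]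
    & D0 a = [set p].

Lemma D_shapeP a : D_shape a.
Proof.
have := mm_D_spec MF a; case E : (mm_class a) => -[i iP Da].
- have lt := partition_point_lt (ltnSn i) iP.
  by apply: (D_cell (i := i)) => //; rewrite /D0 E Da open_part_itv // ltW.
- by apply: (D_point (p := P`_i)); rewrite ?E ?mem_nth // /D0 E.
- by apply: (D_point (p := P`_i)); rewrite ?E ?mem_nth // /D0 E.
Qed.

Variant R_shape a : Prop :=
| R_interval u v of mm_class a <> class2 & u \in P & v \in P & u < v &
    mm_R a = `[u, v]%classic & R0 a = `]u, v[%classic
| R_point q of mm_class a = class2 & q \in P & mm_R a = [set q]
    & R0 a = [set q].

Lemma R_shapeP a : R_shape a.
Proof.
have [u [v [uP vP uv Ra]]] := mm_R_spec MF a; case E : (mm_class a) => H.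
- by apply: (R_interval (u := u) (v := v)) => //; rewrite ?E // /R0 E Ra open_part_itv.
- by apply: (R_interval (u := u) (v := v)) => //; rewrite ?E // ?/R0 ?E ?Ra ?open_part_itv //; case: H.
- by apply: (R_point (q := u)) => //; rewrite /R0 ?E Ra -H set_itv1.
Qed.

Lemma D0_sub a x : D0 a x -> mm_D a x.
Proof.
case: (D_shapeP a) => [i _ _ lt -> ->|p _ _ -> -> //].
by rewrite /= !in_itv /=; lra.
Qed.

Lemma R0_sub a y : R0 a y -> mm_R a y.
Proof.
case: (R_shapeP a) => [u v _ _ _ lt -> ->|p _ _ -> -> //].
by rewrite /= !in_itv /=; lra.
Qed.

Lemma D_unit a x : mm_D a x -> unit_interval x.
Proof. by move=> Dx; rewrite (mm_D_cover MF); exists a. Qed.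

Lemma R_unit a y : mm_R a y -> unit_interval y.
Proof.
case: (R_shapeP a) => [u v _ uP vP lt -> _|p _ /partition_point_unit ? -> _ /= -> //].
have := partition_point_unit uP; have := partition_point_unit vP.
by rewrite /unit_interval /= !in_itv /=; lra.
Qed.

(** The Markov property: [D0 b] is a point or an open cell free of partition points, and [R0 a] is
    bounded by partition points, so meeting forces inclusion. *)
Lemma D0_meet_R0 a b x : R0 a x -> D0 b x -> transition a b.
Proof.
rewrite /transition => Rx Dx; apply/asboolP; move: Rx Dx.
case: (D_shapeP b) => [i _ iP lt _ ->|p _ _ _ ->]; last by move=> Rp /= xp z /= ->; rewrite -xp.
case: (R_shapeP a) => [u v _ uP vP uv _ ->|q _ qP _ ->]; last first.
  by move=> /= ->; rewrite in_itv /= => /(cell_avoids_P iP qP).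
rewrite /= !in_itv /= => ux ix y /=; rewrite !in_itv /=.
have := cell_avoids_P iP uP; have := cell_avoids_P iP vP => nv nu.
have : u <= P`_i by rewrite leNgt; apply/negP => h; apply: nu; lra.
have : P`_i.+1 <= v by rewrite leNgt; apply/negP => h; apply: nv; lra.
lra.
Qed.

Lemma transition_D0 a b x : transition a b -> D0 b x -> R0 a x.
Proof. by move=> /asboolP; apply. Qed.

(** The closed range of [a] contains the open cell [D0 b], hence its closure. *)
Lemma transition_D a b x : transition a b -> mm_D b x -> mm_R a x.
Proof.
move=> ab; case: (D_shapeP b) => [i _ iP lt Db D0b|p _ _ -> Db Dx]; last first.
  by apply: R0_sub; apply: transition_D0 ab _; rewrite Db.
have sub z : `]P`_i, P`_i.+1[%classic z -> mm_R a z.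
  by move=> Dz; apply/R0_sub/(transition_D0 ab); rewrite D0b.
have mid : `]P`_i, P`_i.+1[%classic ((P`_i + P`_i.+1) / 2).
  by rewrite /= in_itv /=; lra.
rewrite Db; case: (R_shapeP a) sub => [u v _ _ _ uv -> _|q _ _ -> _] sub.
  have := sub _ mid; rewrite /= !in_itv /= => hm hx.
  apply/andP; split; rewrite leNgt; apply/negP => h.
    have := sub ((P`_i + u) / 2); rewrite /= !in_itv /= => /(_ ltac:(lra)).
    lra.
  have := sub ((P`_i.+1 + v) / 2); rewrite /= !in_itv /= => /(_ ltac:(lra)).
  lra.
(* Two distinct points of the cell cannot both lie in a one-point range. *)
have /sub /= E1 := mid.
have /sub /= E2 : `]P`_i, P`_i.+1[%classic ((P`_i + 3 * P`_i.+1) / 4).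
  by rewrite /= in_itv /=; lra.
lra.
Qed.

Lemma ginv_point a p : mm_class a <> class0 -> mm_D a = [set p] ->
  ginv a = cst p.
Proof.
rewrite /ginv => Ca ->; have -> : get [set p] = p by exact: (xgetI _ (erefl p : [set p] p)).
by case: (mm_class a) Ca.
Qed.

(** In all three classes an edge read backwards is a function: the earlier point is determined by
    the symbol and the later point. *)
Lemma graphP a x y : graph a (x, y) <-> mm_R a y /\ x = ginv a y.
Proof.
case: (pselect (mm_class a = class0)) => [C|C].
  rewrite /graph /ginv C /=.
  have [[fsub finj fsurj] _ _] := mm_f_spec MF C.
  split=> [[Dx ->]|[Ry ->]].
    split; first exact: fsub.
    by rewrite /inverse_on pinvKV ?inE //.
  have [x' Dx' E] := fsurj _ Ry.
  rewrite -E /inverse_on pinvKV ?inE //.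
case: (D_shapeP a) => [i /C //|p _ _ Da _].
rewrite (ginv_point C Da).
have -> : graph a = mm_D a `*` mm_R a by rewrite /graph; case: (mm_class a) C.
by rewrite Da /=; split=> -[]; move=> *; split.
Qed.

Lemma ginv_D a y : mm_R a y -> mm_D a (ginv a y).
Proof.
move=> Ry; have : graph a (ginv a y, y) by apply/graphP.
by rewrite /graph; case: (mm_class a) => -[].
Qed.

Lemma graph_D a x y : graph a (x, y) -> mm_D a x.
Proof. by move=> /graphP[Ry ->]; exact: ginv_D. Qed.

Lemma graph_R a x y : graph a (x, y) -> mm_R a y.
Proof. by move=> /graphP[]. Qed.

Lemma ginv_cont a : cont_on (mm_R a) (ginv a).
Proof.
case: (pselect (mm_class a = class0)) => [C|C].
  by apply/cont_onP; rewrite /ginv C; case: (mm_f_spec MF C).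
case: (D_shapeP a) => [i /C //|p _ _ Da _].
rewrite (ginv_point C Da) => x e _ e0; exists 1 => // y _ _.
by rewrite /cst subrr normr0.
Qed.

(** The homeomorphism sends endpoints to endpoints, hence interior to interior. *)
Lemma cell_endpoints a x : mm_class a = class0 -> mm_D a x ->
  D0 a x <-> R0 a (mm_f a x).
Proof.
move=> C; have [fb fc _] := mm_f_spec MF C.
case: (D_shapeP a) => [i _ _ lt Da ->|? /(_ C)//].
case: (R_shapeP a) => [u v _ _ _ uv Ra ->|q]; last by rewrite C.
clear C.
rewrite Da Ra in fb fc *; have E := bij_itv_endpoints lt (ltW uv) fc fb.
have [fsub finj _] := fb.
move=> Dx; have := fsub _ Dx.
have Ip : `[P`_i, P`_i.+1]%classic P`_i by rewrite /= in_itv /= lexx ltW.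
have Iq : `[P`_i, P`_i.+1]%classic P`_i.+1 by rewrite /= in_itv /= lexx ltW.
move: (Dx); rewrite /= !in_itv /= => Dx' Rx.
have inj z : `[P`_i, P`_i.+1]%classic z -> mm_f a z = mm_f a x -> z = x.
  by move=> Jz; exact: finj (mem_set Jz) (mem_set Dx).
have /= fu : [set mm_f a P`_i; mm_f a P`_i.+1] u by rewrite E; left.
have /= fv : [set mm_f a P`_i; mm_f a P`_i.+1] v by rewrite E; right.
have /= fp : [set u; v] (mm_f a P`_i) by rewrite -E; left.
have /= fq : [set u; v] (mm_f a P`_i.+1) by rewrite -E; right.
split=> /andP[l1 l2].
  apply/andP; split; rewrite lt_neqAle; apply/andP; split; try lra;
    apply/eqP => H.
    by case: fu => fu; [have := inj _ Ip|have := inj _ Iq]; rewrite -H -fu => /(_ erefl); lra.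
  by case: fv => fv; [have := inj _ Ip|have := inj _ Iq]; rewrite H -fv => /(_ erefl); lra.
apply/andP; split; rewrite lt_neqAle; apply/andP; split; try lra;
  apply/eqP => H.
  by rewrite H in fp; lra.
by rewrite -H in fq; lra.
Qed.

(** Openness need only be tested on the range: in class 0 it transfers to the domain by
    [cell_endpoints], and otherwise [D0 a] is all of [mm_D a]. *)
Lemma graph0P a x y : graph0 a (x, y) <-> graph a (x, y) /\ R0 a y.
Proof.
case: (pselect (mm_class a = class0)) => [C|C].
  rewrite /graph /graph0 C /=; split=> [[Dx ->]|[[Dx ->] Ry]].
    by split; [split=> //; exact: D0_sub|apply/(cell_endpoints C) => //; exact: D0_sub].
  by split=> //; apply/(cell_endpoints C).
have -> : graph a = mm_D a `*` mm_R a by rewrite /graph; case: (mm_class a) C.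
have -> : graph0 a = D0 a `*` R0 a by rewrite /graph0; case: (mm_class a) C.
case: (D_shapeP a) => [i /C //|p _ _ -> ->] /=.
split=> [[-> Ry]|[[-> _] Ry]]; split=> //.
by split => //; exact: R0_sub.
Qed.

Lemma graph0_D0 a x y : graph0 a (x, y) -> D0 a x.
Proof. by rewrite /graph0; case: (mm_class a) => -[]. Qed.

Lemma graph0_R0 a x y : graph0 a (x, y) -> R0 a y.
Proof. by move=> /graph0P[]. Qed.

Lemma graph0_graph a x y : graph0 a (x, y) -> graph a (x, y).
Proof. by move=> /graph0P[]. Qed.

Lemma graphF_symbol x y : graphF F (x, y) -> exists a, graph0 a (x, y).
Proof. by have [<- _ _] := PF => -[a _ ?]; exists a. Qed.

Lemma graph0_inj a b z : graph0 a z -> graph0 b z -> a = b.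
Proof. by have [_ tI _] := PF => az bz; apply: tI => //; exists z. Qed.

Lemma next_symbol y : unit_interval y -> exists b, D0 b y.
Proof.
rewrite (mm_D_cover MF) => -[a _ Da].
have [z az] : exists z, graph a (y, z).
  case: (pselect (mm_class a = class0)) => [C|C].
    by exists (mm_f a y); rewrite /graph C.
  have [z Rz] : exists z, mm_R a z.
    case: (R_shapeP a) => [u v _ _ _ uv -> _|q _ _ -> _]; last by exists q.
    by exists u; rewrite /= in_itv /= lexx ltW.
  exists z; have -> // : graph a = mm_D a `*` mm_R a.
  by rewrite /graph; case: (mm_class a) C.
have [b bz] : exists b, graph0 b (y, z) by apply: graphF_symbol; exists a.
by exists b; exact: graph0_D0 bz.
Qed.

(** As a block of a partition [graph0 a] is nonempty; the second coordinate of one of its points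
    lies in some [D0 b]. *)
Lemma transition_total a : exists b, transition a b.
Proof.
have [_ _ /(_ a I)[[x y] /graph0P[/graph_R Ry R0y]]] := PF.
have [b Db] := next_symbol (R_unit Ry).
by exists b; exact: D0_meet_R0 Db.
Qed.

(* An arc [graph0 a] is relatively open in the graph of F: no other closed piece
   touches it. *)
Lemma graph0_isolated a b x y : mm_class a <> class2 ->
  graph0 a (x, y) -> graph b (x, y) -> a = b.
Proof.
move=> C2 az bz; apply: (graph0_inj az); apply/graph0P; split=> //.
have /graph0P[ga Ra] := az; have Dx := graph0_D0 az.
have Db := graph_D bz; have Rb := graph_R bz.
case: (D_shapeP a) Dx => [i C iP lt Da ->|p C pP Da ->] Dx.
  (* Class 0: [x] is interior to a cell, so it is no partition point; thus [b] has class 0 and [x]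
     is interior to its domain. *)
  case: (D_shapeP b) Db => [j Cb jP ltj Db D0b|p _ pP -> _ xp]; last first.
    by move: Dx; rewrite xp /= in_itv /= => /(cell_avoids_P iP pP).
  rewrite Db /= in_itv /= => Dbx.
  have -> : y = mm_f b x by move: bz; rewrite /graph Cb => -[].
  apply/(cell_endpoints Cb); first by rewrite Db /= in_itv.
  rewrite D0b /= in_itv /=; move: Dx; rewrite /= in_itv /= => Dx.
  have n1 := cell_avoids_P iP (mem_nth 0 (ltnW jP)).
  have n2 := cell_avoids_P iP (mem_nth 0 jP).
  clear C Cb C2.
  apply/andP; split; rewrite lt_neqAle; apply/andP; split; try lra;
    apply/eqP => H; first [by apply: n1; lra|by apply: n2; lra].
(* Class 1: the range of [a] meets the partition only at its two endpoints, so [y] avoids the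
   partition and is interior to the range of [b]. *)
have yP : y \notin P.
  apply/negP => yP; have Ca : mm_class a = class1 by move: C C2; case: (mm_class a).
  have [u [v [uP vP uv ERa]]] := mm_R_spec MF a; rewrite Ca => -[ltuv E].
  have : [set u; v] y by rewrite -E; split=> //; exact: R0_sub.
  move: Ra; rewrite /R0 Ca ERa open_part_itv ?ltW //= in_itv /=.
  clear C Ca C2.
  by move=> ? []; lra.
case: (R_shapeP b) (Rb) => [u v _ uP vP uv -> ->|q _ qP -> _ yq]; last first.
  by move: yP; rewrite yq qP.
rewrite /= !in_itv /= => /andP[uy yv].
rewrite !lt_neqAle uy yv !andbT; apply/andP; split; apply/eqP => H.
  by move: yP; rewrite -H uP.
by move: yP; rewrite H vP.
Qed.

End Structure.

(** * Codes and coded trajectories *)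


Section Codes.
Context {R : realType} (F : multimap_data R).
Hypothesis MF : is_markov_multimap F.
Local Notation A := (mm_A F).
Implicit Types (a b : A) (e : nat -> A) (C : set A) (y : nat -> R) (i j k m n : nat).

(* Codes run backwards, as the coordinates of [back_traj] do: the letter [e k]
   labels the edge from [y k.+1] to [y k]. *)
Definition coded e i j y :=
  forall k, (i <= k < j)%N -> graph (e k) (y k.+1, y k).

(** Both end letters are included, whereas [coded e i j] stops at the edge [j - 1]; hence [m] here
    goes with [m.+1] there. *)
Definition bpath C e i j := (forall k, (i <= k <= j)%N -> C (e k)) /\
  forall k, (i <= k < j)%N -> transition (e k.+1) (e k).

Definition splice j e1 e2 : nat -> A := fun k => if (k <= j)%N then e1 k else e2 k.

Lemma bpath_splice C e1 e2 i j k : (i <= j)%N -> e1 j = e2 j ->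
  bpath C e1 i j -> bpath C e2 j k -> bpath C (splice j e1 e2) i k.
Proof.
move=> ij E [C1 T1] [C2 T2]; rewrite /splice; split=> q qk.
  by case: ifP => qj; [apply: C1|apply: C2]; lia.
case: (ltngtP q j) => qj.
- by apply: T1; lia.
- by apply: T2; lia.
- by rewrite qj E; apply: T2; lia.
Qed.

Lemma bpath_sub C e i j i' j' : (i <= i')%N -> (j' <= j)%N ->
  bpath C e i j -> bpath C e i' j'.
Proof. by move=> ii jj [H1 H2]; split=> k h; [apply: H1|apply: H2]; lia. Qed.

Lemma eq_bpath C e e' i j : (forall k, (i <= k <= j)%N -> e k = e' k) ->
  bpath C e i j -> bpath C e' i j.
Proof.
move=> E [H1 H2]; split=> k h; first by rewrite -E //; exact: H1.
by rewrite -!E; [exact: H2|lia|lia].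
Qed.

Lemma bpath_shift C e i j n :
  bpath C e i j -> bpath C (fun k => e (k - n)%N) (i + n) (j + n).
Proof.
move=> [H1 H2]; split=> k h; first by apply: H1; lia.
have -> : (k.+1 - n = (k - n).+1)%N by lia.
by apply: H2; lia.
Qed.

Lemma eq_coded e e' i j y : (forall k, (i <= k < j)%N -> e k = e' k) ->
  coded e i j y -> coded e' i j y.
Proof. by move=> E H k h; rewrite -E //; exact: H. Qed.

Lemma coded_sub e i j i' j' y : (i <= i')%N -> (j' <= j)%N ->
  coded e i j y -> coded e i' j' y.
Proof. by move=> ii jj H k h; apply: H; lia. Qed.

(** The word in forward time, [e (m - 1)] down to [e 0], so that [ginv_word] applies the inverse of
    [e 0] first. *)
Definition bword e m : seq A := mkseq (fun i => e (m - i.+1)%N) m.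

Lemma bwordS e m : bword e m.+1 = e m :: bword e m.
Proof.
rewrite /bword /mkseq /= subn1 /=; congr cons.
rewrite -[1%N]/(1 + 0)%N iotaDl -map_comp.
by apply: eq_map => i /=; rewrite add1n subSS.
Qed.

Lemma last_bword e m a : last a (bword e m.+1) = e 0%N.
Proof.
by elim: m a => [//|m IH] a; rewrite bwordS last_cons; exact: IH.
Qed.

Lemma word_dom_bword e m : word_dom (bword e m.+1) = mm_R (e 0%N).
Proof.
by rewrite bwordS /=; case: m => [//|m]; rewrite last_bword.
Qed.

Lemma coded_ginv_word e m y : coded e 0 m y ->
  forall k, (k <= m)%N -> y k = ginv_word (bword e k) (y 0%N).
Proof.
move=> yc; elim=> [//|k IH] km.
rewrite bwordS /= -IH; last exact: ltnW.
by have /(graphP MF)[_] := yc k km.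
Qed.

(** Each inverse lands in the domain of its symbol, which [transition_D] places in the range of the
    preceding one; so pulling back never leaves the domains of the inverses. *)
Lemma ginv_word_R C e m t : bpath C e 0 m -> mm_R (e 0%N) t ->
  forall k, (k <= m)%N -> mm_R (e k) (ginv_word (bword e k) t).
Proof.
move=> [_ T] Rt; elim=> [//|k IH] km; rewrite bwordS /=.
apply: (transition_D MF (T k _)); first by lia.
by apply/(ginv_D MF)/IH; lia.
Qed.

Lemma ginv_word_coded C e m t : bpath C e 0 m -> mm_R (e 0%N) t ->
  coded e 0 m.+1 (fun k => ginv_word (bword e k) t).
Proof.
move=> p Rt k km; apply/(graphP MF); rewrite bwordS /=; split=> //.
by apply: ginv_word_R p Rt _ _; lia.
Qed.

Lemma ginv_word_cont C e m : bpath C e 0 m ->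
  forall k, (k <= m.+1)%N -> cont_on (mm_R (e 0%N)) (ginv_word (bword e k)).
Proof.
move=> p; elim=> [_|k IH km].
  by move=> x d _ d0; exists d.
rewrite bwordS; apply: (cont_on_comp (K := mm_R (e k))).
- by move=> x Rx; apply: ginv_word_R p Rx _ _; lia.
- exact: ginv_cont.
- by apply: IH; lia.
Qed.

Lemma iter_shiftY n (y : backY F) k :
  set_val (iter n (@shiftY R F) y) k = set_val y (k + n)%N.
Proof.
elim: n k => [|n IH] k; first by rewrite addn0.
by rewrite iterS -addSnnS -IH.
Qed.

Lemma iter_shiftY_id n (y : backY F) :
  (forall k, set_val y (k + n)%N = set_val y k) -> iter n (@shiftY R F) y = y.
Proof.
by move=> yn; apply/val_inj/funext => k; have := iter_shiftY n y k; rewrite yn.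
Qed.

(** One period of inverse maps is a continuous self-map of [mm_R (e 0)], an interval or a point;
    unrolling its fixed point gives the trajectory. *)
Lemma periodic_code e p : (0 < p)%N -> (forall k, e (k + p)%N = e k) ->
  (forall k, transition (e k.+1) (e k)) -> exists y : backY F,
  (forall k, set_val y (k + p)%N = set_val y k) /\
  forall k, graph (e k) (set_val y k.+1, set_val y k).
Proof.
move=> p0 ep T.
have pth m : bpath setT e 0 m by [].
pose w t k := ginv_word (bword e k) t.
have Rp t : mm_R (e 0%N) t -> mm_R (e 0%N) (w t p).
  by move=> Rt; rewrite -ep; exact: (ginv_word_R (pth _) Rt (leqnn p)).
have [t Rt wt] : exists2 t, mm_R (e 0%N) t & w t p = t.
  have := ginv_word_cont (pth p) (leqnSn p).
  case: (R_shapeP MF (e 0%N)) Rp => [u v _ _ _ uv -> _|q _ _ -> _] Rp wc.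
    by apply: (cont_on_fixpoint (ltW uv) wc).
  by exists q => //; exact: Rp.
have wS k : w t k.+1 = ginv (e k) (w t k) by rewrite /w bwordS.
have wp k : w t (k + p)%N = w t k.
  by elim: k => [|k IH]; rewrite ?add0n // addSn !wS IH ep.
have wc k : graph (e k) (w t k.+1, w t k).
  by apply: (ginv_word_coded (pth k) Rt); lia.
have wY : back_traj F (w t).
  move=> k; split; last by exists (e k).
  (* Periodicity moves coordinate [k] to a positive index, where it is the left end of an edge and
     so lies in a domain. *)
  rewrite -wp; case: p p0 {ep Rp wt wp} => // p _.
  by rewrite addnS; exact: (D_unit MF (graph_D MF (wc _))).
by exists (SigSub (mem_set wY)).
Qed.

Lemma periodic_bpath C e i p : (0 < p)%N -> e (i + p)%N = e i ->
  bpath C e i (i + p) -> exists y : backY F,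
  (forall k, set_val y (k + p)%N = set_val y k) /\
  coded e i (i + p) (set_val y).
Proof.
(* Modulo [p], adding [i * (p - 1)] subtracts [i] without truncation, so [e'] agrees with [e] from
   [i] to [i + p - 1]. *)
move=> p0 eip [_ T]; pose e' k := e (i + (k + i * (p - 1)) %% p)%N.
have e'p k : e' (k + p)%N = e' k by rewrite /e' addnAC modnDr.
have e'T k : transition (e' k.+1) (e' k).
  rewrite /e' addSn -addn1 -modnDml.
  have := ltn_pmod (k + i * (p - 1)) p0; set q := (_ %% p)%N => qp.
  case: (ltngtP q.+1 p) => [lt|gt|eq]; last 1 first.
  (* Wrap-around: the letter following the period is [e i], which equals [e (i + p)]. *)
  - by rewrite addn1 eq modnn addn0 -eip -eq addnS; apply: T; lia.
  - by rewrite addn1 modn_small // addnS; apply: T; lia.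
  - by lia.
have [y [yp yc]] := periodic_code p0 e'p e'T; exists y; split=> // k ik.
have := yc k; rewrite /e'.
have -> : (k + i * (p - 1) = i * p + (k - i))%N by nia.
by rewrite modnMDl modn_small ?subnKC //; lia.
Qed.

(** Words of the language occur in infinite sequences, so the path is prolonged beyond [e 0] by
    successors chosen in [C]. *)
Lemma lang_n_bword C e m : (forall a, C a -> exists2 b, C b & transition a b) ->
  bpath C e 0 m -> lang_n (SigmaM_in C) m.+1 (bword e m.+1).
Proof.
move=> nxt [Ce Te].
have [f fP] : {f : A -> A & forall a, C a -> C (f a) /\ transition a (f a)}.
  apply: (@choice _ _ (fun a b => C a -> C b /\ transition a b)) => a.
  case: (pselect (C a)) => [/nxt[b ? ?]|nC]; [by exists b|by exists a].
have Cf q : C (iter q f (e 0%N)).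
  by elim: q => [|q IH]; [exact: Ce|exact: (fP _ IH).1].
exists (fun q => if (q <= m)%N then e (m - q)%N else iter (q - m) f (e 0%N)), 0%N.
split; last first.
  apply/eq_in_map => q; rewrite mem_iota add0n => /= qm.
  by rewrite -ltnS qm subSS.
split=> q; last by case: ifP => h; [apply: Ce; lia|exact: Cf].
case: ltngtP => h; last 1 first.
- by rewrite h subnn subSnn; exact: (fP _ (Cf 0%N)).2.
- have -> : (m - q = (m - q.+1).+1)%N by lia.
  by apply: Te; rewrite leq0n /=; lia.
- have -> : (q.+1 - m = (q - m).+1)%N by lia.
  exact: (fP _ (Cf _)).2.
Qed.

Lemma lang_n_ends Z n u a b : lang_n Z n u -> begins_ends a b u ->
  exists s k, [/\ Z s, (0 < n)%N, s k = a & s (k + n.-1)%N = b].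
Proof.
move=> [s [k [Zs ->]]] [v uv vb]; exists s, k.
case: n uv => [//|n]; rewrite /mkseq /= => -[ka vE]; rewrite addn0 in ka.
split=> //; rewrite -vb -vE -ka; case: n {vE} => [|n]; first by rewrite addn0.
rewrite -nth_last size_map size_iota (nth_map 0%N) ?size_iota //.
by rewrite nth_iota.
Qed.

(** Time reversal: the index [n - (q - i)] runs through the segment of [s] from its end to its
    start. *)
Lemma SigmaM_in_bpath C s k n i a b : SigmaM_in C s -> s k = a ->
  s (k + n)%N = b -> exists e, [/\ bpath C e i (i + n), e i = b & e (i + n)%N = a].
Proof.
move=> [sM sC] ka kb; exists (fun q => s (k + (n - (q - i)))%N); split.
- split=> q h; first exact: sC.
  have -> : (n - (q - i) = (n - (q.+1 - i)).+1)%N by lia.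
  by rewrite addnS; exact: sM.
- by rewrite subnn subn0.
- by rewrite addKn subnn addn0.
Qed.

Lemma irreducible_succ C a : irreducible C -> C a -> exists2 b, C b & transition a b.
Proof.
move=> irr Ca; have [u [n _ un] aau] := irr a a Ca Ca.
have [s [k [[sM sC] _ <- _]]] := lang_n_ends un aau.
by exists (s k.+1).
Qed.

Lemma mixing_irreducible C : mixing C -> irreducible C.
Proof.
move=> [N _ mix] a b Ca Cb; have [u ? ?] := mix a b Ca Cb N (leqnn N).
by exists u => //; exists N.
Qed.

(** When [a = b] the word given by irreducibility may have one letter. Starting it at a successor
    [c] of [b] ensures at least one transition. *)
Lemma irreducible_link C a b i : irreducible C -> C a -> C b ->
  exists e j, [/\ (i < j)%N, bpath C e i j, e i = a & e j = b].
Proof.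
move=> irr Ca Cb; have [c Cc bc] := irreducible_succ irr Cb.
have [u [n _ un] cau] := irr c a Cc Ca.
have [s [k [sM n0 kc ka]]] := lang_n_ends un cau.
have [e [ep ea ec]] := SigmaM_in_bpath i sM kc ka.
exists (splice (i + n.-1) e (fun=> b)), (i + n)%N; split=> //.
- by lia.
- split=> q h; first by rewrite /splice; case: ifP => // ?; apply: ep.1; lia.
  rewrite /splice; case: (ltngtP q (i + n.-1)%N) => h'; last 1 first.
  + by rewrite h' ec.
  + by apply: ep.2; lia.
  + by lia.
- by rewrite /splice leq_addr.
- rewrite /splice; have -> // : (i + n <= i + n.-1)%N = false by lia.
Qed.

Lemma mixing_link C : mixing C -> exists N, forall a b i j, C a -> C b ->
  (i + N <= j)%N -> exists e, [/\ bpath C e i j, e i = a & e j = b].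
Proof.
move=> [N N0 mix]; exists N => a b i j Ca Cb ij.
have [u un bau] := mix b a Cb Ca (j - i).+1 ltac:(by lia).
have [s [k [sM n0 kc ka]]] := lang_n_ends un bau.
have := SigmaM_in_bpath i sM kc ka; rewrite /= subnKC //; lia.
Qed.

End Codes.

(** * Essential words *)


Lemma row_ballP (R : realType) n (x z : 'rV[R]_n) r :
  ball x r z <-> 0 < r /\ forall i, `|x 0 i - z 0 i| < r.
Proof.
split=> -[r0 H]; split=> // i; first exact: H.
by move=> j; rewrite ord1; exact: H.
Qed.

Section Essential.
Context {R : realType} (F : multimap_data R).
Hypothesis MF : is_markov_multimap F.
Hypothesis PF : properly_parametrized F.
Local Notation A := (mm_A F).
Implicit Types (a b : A) (e w : nat -> A) (C : set A) (y : nat -> R) (i j k m n : nat).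

(** The open pieces partition the graph, so here, unlike for [coded], the trajectory determines the
    letters. *)
Definition coded0 e n y := forall k, (k < n)%N -> graph0 (e k) (y k.+1, y k).

Lemma coded0_coded e n y : coded0 e n y -> coded e 0 n y.
Proof. by move=> ye k kn; apply: (graph0_graph MF); apply: ye. Qed.

Lemma graphF_coded0 n y : (forall k, (k < n)%N -> graphF F (y k.+1, y k)) ->
  exists e, coded0 e n y.
Proof.
move=> yF; suff : {e : nat -> A & forall k, (k < n)%N -> graph0 (e k) (y k.+1, y k)}.
  by case=> e ?; exists e.
apply: (@choice _ _ (fun k a => (k < n)%N -> graph0 a (y k.+1, y k))) => k.
case: (ltnP k n) => [kn|_].
  by have [a ?] := graphF_symbol PF (yF k kn); exists a.
have [a _] : exists a, D0 a (0 : R).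
  by apply: next_symbol => //; rewrite /unit_interval /= in_itv /= lexx ler01.
by exists a.
Qed.

Lemma coded0_bpath e m y : coded0 e m.+1 y -> bpath setT e 0 m.
Proof.
move=> ye; split=> // k km.
apply: (D0_meet_R0 MF (x := y k.+1)).
  by apply: (graph0_R0 MF); apply: ye.
by apply: graph0_D0 (ye k _); lia.
Qed.

(** Once [w k = e k], the transition from [w k.+1] puts [y k.+1] in its open range; the next edge is
    then open for both symbols, and these agree. *)
Lemma coded0_unique w e m y : bpath setT w 0 m -> coded w 0 m.+1 y ->
  coded0 e m.+1 y -> w 0%N = e 0%N -> forall k, (k <= m)%N -> w k = e k.
Proof.
move=> [_ T] yw ye w0; elim=> [//|k IH] km.
have {}IH := IH (ltnW km).
apply: (graph0_inj PF (z := (y k.+2, y k.+1))); last exact: ye.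
apply/(graph0P MF); split; first exact: yw.
apply: (transition_D0 (T k _)); first by lia.
by rewrite IH; apply: graph0_D0 (ye k _); lia.
Qed.

Definition btuple e n : n.-tuple A := [tuple e (n - i.+1)%N | i < n].

Lemma btupleE e n : btuple e n = bword e n :> seq A.
Proof. by rewrite /= /bword /mkseq -val_enum_ord -map_comp. Qed.

Section Rows.
Variable m : nat.
Implicit Type x : 'rV[R]_m.+2.

(** A row lists points in forward time; here index 0 reads its last entry. *)
Definition back_row x : nat -> R := fun k => x 0 (inord (m.+1 - k)).

Lemma fin_traj_back_row x : fin_traj F x -> forall k, (k <= m)%N ->
  graphF F (back_row x k.+1, back_row x k).
Proof.
move=> [_ xF] k km; apply: xF; rewrite !inordK; lia.
Qed.

Lemma coded0_back_row e x : coded0 e m.+1 (back_row x) <->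
  forall k : 'I_m.+1, graph0 (tnth (btuple e m.+1) k)
    (x 0 (widen_ord (leqnSn m.+1) k), x 0 (lift ord0 k)).
Proof.
split=> H k.
  rewrite tnth_mktuple subSS; have := H (m - k)%N; rewrite /back_row.
  have -> : inord (m.+1 - (m - k).+1) = widen_ord (leqnSn m.+1) k.
    by apply/val_inj; rewrite /= inordK; have := ltn_ord k; lia.
  have -> : inord (m.+1 - (m - k)) = lift ord0 k.
    by apply/val_inj; rewrite /= /bump inordK; have := ltn_ord k; lia.
  by apply; lia.
move=> km; have mk : (m - k < m.+1)%N by lia.
have := H (Ordinal mk); rewrite tnth_mktuple /= subSS subKn; last by lia.
rewrite /back_row.
have -> : inord (m.+1 - k.+1) = widen_ord (leqnSn m.+1) (Ordinal mk).
  by apply/val_inj; rewrite /= inordK; lia.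
have -> // : inord (m.+1 - k) = lift ord0 (Ordinal mk).
by apply/val_inj; rewrite /= /bump inordK; lia.
Qed.

(** By [graphP] this is the graph of a continuous function over a closed set. *)
Lemma closed_graph_coord a (i j : 'I_m.+2) :
  closed [set x : 'rV[R]_m.+2 | graph a (x 0 i, x 0 j)].
Proof.
have closedR : closed (mm_R a).
  case: (R_shapeP MF a) => [u v _ _ _ _ -> _|q _ _ -> _].
    exact: interval_closed.
  by rewrite -(set_itv1 q); exact: interval_closed.
move=> x xcl; apply/(graphP MF).
have Rx : mm_R a (x 0 j).
  have : closed [set x : 'rV[R]_m.+2 | mm_R a (x 0 j)].
    by apply: preimage_closed closedR => z _; exact: coord_continuous.
  by apply => B Bx; have [z [/(graph_R MF) ? ?]] := xcl B Bx; exists z.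
split=> //; apply/eqP; rewrite -subr_eq0 -normr_eq0; apply/negPn/negP => ne.
set r := `|_| in ne; have r0 : 0 < r by rewrite lt_neqAle eq_sym ne normr_ge0.
have [d d0 gd] := ginv_cont MF Rx (ltac:(by lra) : 0 < r / 2).
have [|z [/(graphP MF) [Rz zg]]] := xcl (ball x (Num.min d (r / 2))).
  by apply: nbhsx_ballx; rewrite lt_min d0; lra.
move=> /row_ballP[_ xz]; have := xz i; have := xz j; rewrite !lt_min.
move=> /andP[/(gd _ Rz) A1 _] /andP[_]; rewrite zg => A2.
have : r <= `|x 0 i - ginv a (z 0 j)| + `|ginv a (x 0 j) - ginv a (z 0 j)|.
  rewrite /r (_ : _ - _ = (x 0 i - ginv a (z 0 j)) - (ginv a (x 0 j) - ginv a (z 0 j))).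
    exact: ler_normB.
  by lra.
lra.
Qed.

Lemma closed_coded_row w : closed [set x | coded w 0 m.+1 (back_row x)].
Proof.
rewrite (_ : [set _ | _] = \bigcap_(k in [set k | (k < m.+1)%N])
    [set x | graph (w k) (back_row x k.+1, back_row x k)]).
  by apply: closed_bigI => k _; exact: closed_graph_coord.
by apply/seteqP; split=> x H k; exact: H.
Qed.

(* The finitely many other admissible codes cut out closed sets; removing them
   from [B] leaves exactly the trajectories coded by [e]. *)
Lemma essential_criterion e (B : set 'rV[R]_m.+2) (Q : A -> Prop) :
  bpath setT e 0 m -> open B ->
  (forall x, coded0 e m.+1 (back_row x) -> B x) ->
  (forall x w, fin_traj F x -> B x -> coded0 w m.+1 (back_row x) -> Q (w 0%N)) ->
  (forall x w, coded0 e m.+1 (back_row x) -> coded w 0 m.+1 (back_row x) ->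
     Q (w 0%N) -> w 0%N = e 0%N) ->
  essential_word (btuple e m.+1).
Proof.
move=> ep oB eB BQ Qe; split.
  have [s [k [[sM _] E]]] : lang_n (SigmaM_in setT) m.+1 (bword e m.+1).
    by apply: lang_n_bword ep => a _; have [b ab] := transition_total MF PF a; exists b.
  by exists s, k; rewrite btupleE.
(* Codes are cut to [m.+1] letters so that the removed union is finite. [Q] holds for the last
   letter of every code met in [B], so only such codes need removing. *)
pose ext (w : {ffun 'I_m.+1 -> A}) k := w (inord k).
pose W := [set w | [/\ bpath setT (ext w) 0 m, Q (ext w 0%N) &
  exists2 k, (k <= m)%N & ext w k <> e k]].
apply/open_subspaceP; exists (B `&` ~` \bigcup_(w in W)
    [set x | coded (ext w) 0 m.+1 (back_row x)]).
  apply: openI => //; apply: closed_openC; apply: closed_bigcup => [|w _].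
    exact: finite_finset.
  exact: closed_coded_row.
apply/seteqP; split=> x [] [].
  move=> Bx nW xF; split=> //; split=> //; apply/coded0_back_row.
  have [w xw] : exists w, coded0 w m.+1 (back_row x).
    by apply: graphF_coded0 => k km; apply: fin_traj_back_row.
  suff we k : (k < m.+1)%N -> w k = e k by move=> k km; rewrite -we //; exact: xw.
  move=> km; apply: contrapT => wek; apply: nW.
  have extE q : (q <= m)%N -> ext [ffun i : 'I_m.+1 => w i] q = w q.
    by move=> qm; rewrite /ext ffunE inordK.
  exists [ffun i : 'I_m.+1 => w i]; last first.
    by apply: eq_coded (coded0_coded xw) => q qm; rewrite extE //; lia.
  split; last by exists k => //; rewrite extE.
    by apply: eq_bpath (coded0_bpath xw) => q qm; rewrite extE //; lia.
  by rewrite extE //; exact: BQ xw.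
move=> xF /coded0_back_row xe _; split=> //; split; first exact: eB.
move=> [w [wp Qw [k km ne]]] wx; apply: ne.
by apply: coded0_unique wp wx xe (Qe _ _ xe wx Qw) _ km.
Qed.

End Rows.

(** By [graph0_isolated] the final edge fixes the last letter of any competing code, so the
    criterion applies with trivial [B] and [Q]. *)
Lemma essential_arc e m : bpath setT e 0 m -> mm_class (e 0%N) <> class2 ->
  essential_word (btuple e m.+1).
Proof.
move=> ep C2; apply: (essential_criterion (B := setT) (Q := fun=> True)) => //.
  exact: openT.
move=> x w xe xw _; symmetry; apply: (graph0_isolated MF PF C2 (xe 0%N _)) => //.
exact: xw.
Qed.

Lemma essential_in C e m : @essential_symbols R F `<=` C ->
  essential_word (btuple e m.+1) -> bpath setT e 0 m -> bpath C e 0 m.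
Proof.
move=> eC eW [_ T]; split=> // k km; apply: eC; exists m.+1, (btuple e m.+1).
split=> //; rewrite memtE btupleE; apply/mapP; exists (m - k)%N.
  by rewrite mem_iota; lia.
by congr e; lia.
Qed.

Lemma essential_class C a : @essential_symbols R F `<=` C ->
  mm_class a <> class2 -> C a.
Proof.
move=> eC C2; have ap : bpath setT (fun=> a) 0 0 by split=> // k; lia.
exact: (essential_in eC (essential_arc ap C2) ap).1 0%N isT.
Qed.

Lemma essential_dense C y m (r : R) : @essential_symbols R F `<=` C -> 0 < r ->
  (forall k, (k < m.+1)%N -> graphF F (y k.+1, y k)) ->
  exists e z, [/\ bpath C e 0 m, coded e 0 m.+1 z, R0 (e 0%N) (z 0%N) &
    forall k, (k <= m.+1)%N -> `|y k - z k| < r].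
Proof.
move=> eC r0 yF; have [e ye] := graphF_coded0 yF.
have ep := coded0_bpath ye.
have self : essential_word (btuple e m.+1) ->
    exists e z, [/\ bpath C e 0 m, coded e 0 m.+1 z, R0 (e 0%N) (z 0%N) &
      forall k, (k <= m.+1)%N -> `|y k - z k| < r].
  move=> eW; exists e, y; split.
  - exact: essential_in eC eW ep.
  - exact: coded0_coded.
  - exact: (graph0_R0 MF (ye 0%N _)).
  - by move=> k _; rewrite subrr normr0.
case: (pselect (mm_class (e 0%N) = class2)) => [C2|C2]; last exact/self/essential_arc.
(* Suppose there is no witness. Then every code occurring within [r] of [y] ends in class 2, and the
   criterion makes [e] essential, so [y] itself is a witness. *)
apply: contrapT => no; apply: (no); apply: self.
pose x0 : 'rV[R]_m.+2 := \row_i y (m.+1 - i)%N.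
have x0E k : (k <= m.+1)%N -> back_row x0 k = y k.
  by move=> km; rewrite /back_row mxE inordK ?subKn //; lia.
(* A code ending in class 2 has at most one trajectory, since its last point is prescribed. *)
have det z : coded0 e m.+1 z -> forall k, (k <= m.+1)%N -> z k = y k.
  move=> ze k km; rewrite (coded_ginv_word MF (coded0_coded ze)) //.
  rewrite [RHS](coded_ginv_word MF (coded0_coded ye)) //; congr (_ _).
  have := graph0_R0 MF (ze 0%N (ltn0Sn _)); have := graph0_R0 MF (ye 0%N (ltn0Sn _)).
  by case: (R_shapeP MF (e 0%N)) => [? ? /(_ C2)//|q _ _ _ ->] /= -> ->.
apply: (essential_criterion (B := ball x0 r) (Q := fun a => mm_class a = class2)) => //.
- exact: ball_open.
- move=> x xe; apply/row_ballP; split=> // j.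
  have jm : (m.+1 - j <= m.+1)%N by lia.
  have xj : x 0 j = back_row x (m.+1 - j).
    by rewrite /back_row subKn ?inord_val //; have := ltn_ord j; lia.
  rewrite mxE xj (det _ xe) // subrr normr0 //.
- move=> x w xF Bx xw; apply: contrapT => Cw; apply: no.
  exists w, (back_row x); split.
  + by apply: essential_in eC (essential_arc _ Cw) _; exact: coded0_bpath xw.
  + exact: coded0_coded.
  + exact: (graph0_R0 MF (xw 0%N _)).
  + move=> k km; rewrite -x0E //; have /row_ballP[_] := Bx; exact.
(* In class 2 the closed and open pieces coincide, so the last letter is unique. *)
- move=> x w xe xw Cw; apply: (graph0_inj PF) (xe 0%N _) => //.
  apply/(graph0P MF); split; first exact: xw.
  have := graph_R MF (xw 0%N (ltn0Sn _)).
  by case: (R_shapeP MF (w 0%N)) => [? ? /(_ Cw)//|q _ _ -> ->].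
Qed.

End Essential.

(** * Shadowing *)


Section Tracking.
Context {R : realType} (F : multimap_data R).
Hypothesis MF : is_markov_multimap F.
Hypothesis PF : properly_parametrized F.
Local Notation A := (mm_A F).
Implicit Types (a b : A) (e : nat -> A) (y w z : nat -> R) (i j k m n : nat).

Lemma len_ge (J : set R) (x y : R) : J `<=` unit_interval -> J x -> J y ->
  `|x - y| <= len J.
Proof.
move=> J01; rewrite /len.
have ubJ : has_ubound J by exists 1 => z /J01; rewrite /unit_interval /= in_itv => /andP[].
have lbJ : has_lbound J by exists 0 => z /J01; rewrite /unit_interval /= in_itv => /andP[].
move=> Jx Jy; have := ub_le_sup ubJ Jx; have := ub_le_sup ubJ Jy.
have := ge_inf lbJ Jx; have := ge_inf lbJ Jy.
by move=> *; rewrite ler_norml; lra.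
Qed.

Lemma traj_ginv_word (s : nat -> A) (x : nat -> R) :
  (forall i, graph (s i) (x i, x i.+1)) ->
  forall i, x 0%N = ginv_word (mkseq s i) (x i).
Proof.
move=> xs; elim=> [//|i IH].
rewrite mkseqS /ginv_word foldr_rcons /=; have /(graphP MF)[_ xi] := xs i.
rewrite IH xi /ginv_word; elim: (mkseq s i) => //= a u ->.
by [].
Qed.

Lemma bword_rev (s : nat -> A) n : bword (fun q => s (n - q.+1)%N) n = mkseq s n.
Proof.
apply/eq_in_map => i; rewrite mem_iota add0n => /= ilt.
by congr s; lia.
Qed.

Lemma Iword_bword C e m y : bpath C e 0 m -> coded e 0 m.+1 y ->
  Iword (bword e m.+1) (y m.+1).
Proof.
move=> ep yc; exists (y 0%N); last by rewrite -(coded_ginv_word MF yc).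
by rewrite word_dom_bword; exact: (graph_R MF (yc 0%N _)).
Qed.

Lemma Iword_unit C e m : bpath C e 0 m ->
  Iword (bword e m.+1) `<=` unit_interval.
Proof.
move=> ep _ [t Rt <-]; rewrite word_dom_bword in Rt.
exact: (D_unit MF (graph_D MF (ginv_word_coded MF ep Rt (ltnSn m)))).
Qed.

(** There are finitely many words of bounded length; inadmissible ones are included, which only
    enlarges the list. *)
Lemma preimages_of_partition n : exists B : seq R, forall (u : seq A) p,
  (size u < n)%N -> p \in mm_P F -> ginv_word u p \in B.
Proof.
elim: n => [|n [B IH]]; first by exists [::].
exists (mm_P F ++ [seq ginv a x | a <- enum A, x <- B]) => -[|a u] p /= un pP.
  by rewrite mem_cat pP.
rewrite mem_cat; apply/orP; right; apply/allpairsP.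
by exists (a, ginv_word u p); split => //=; [rewrite mem_enum|exact: IH].
Qed.

(* A target in an open arc is perturbed off the finitely many preimages of
   the partition; its forward itinerary then uses only symbols of class 0, which
   are essential. *)
Lemma coding_extension C r : @essential_symbols R F `<=` C -> irreducible C ->
  coding_condition F -> 0 < r ->
  exists n, forall b t, C b -> R0 b t -> exists e,
    [/\ bpath C e 0 n.+1, e n.+1 = b &
        forall y, coded e 0 n.+1 y -> `|y n.+1 - t| < r].
Proof.
move=> eC irr [Z [[ZM _ _] _ cov lim]] r0.
(* Half of [r] bounds the arc [Iword u], the other half the perturbation of [t]. *)
have [n0 _ small] : exists2 n, True & forall u : n.+1.-tuple A,
    lang_n Z n.+1 u -> len (Iword u) < r / 2.
  move/cvgrPdist_lt: lim => /(_ (r / 2) ltac:(by lra)) [n _ /(_ n.+1 (leqnSn n))].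
  rewrite sub0r normrN => small; exists n => // u uZ.
  apply: le_lt_trans small; apply: le_trans (ler_norm _).
  by apply: (le_bigmax_cond _ (fun u : n.+1.-tuple A => len (Iword u))); rewrite inE.
exists n0 => b t Cb Rt; set n := n0.+1.
(* If [b] has class 2 its range is a point, so any continuation in [C] meets [t] exactly. *)
case: (pselect (mm_class b = class2)) => [C2|C2].
  have [e ep eb] : exists2 e, bpath C e 0 n & e n = b.
    elim: (n) b Cb {Rt C2} => [|k IH] b Cb.
      by exists (fun=> b) => //; split=> q h //; lia.
    have [c Cc bc] := irreducible_succ irr Cb; have [e ep ec] := IH c Cc.
    exists (splice k e (fun=> b)); last by rewrite /splice ltnn.
    split=> q qk; rewrite /splice; first by case: ifP => // ?; apply: ep.1; lia.
    by case: (ltngtP q k) => h; [apply: ep.2; lia|lia|rewrite h ec].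
  exists e; split=> // y yc.
  have : mm_R b (y n).
    apply: (transition_D MF (b := e n0)); last by apply: (graph_D MF (yc n0 _)); lia.
    by rewrite -eb; apply: ep.2; lia.
  move: Rt; case: (R_shapeP MF b) => [? ? /(_ C2)//|q _ _ -> ->] /= -> ->.
  by rewrite subrr normr0.
have [u [v [ut tv uv Rb]]] : exists u v, [/\ t - r / 2 <= u, v <= t + r / 2, u < v &
    forall x, u < x < v -> R0 b x].
  move: Rt; case: (R_shapeP MF b) => [u v _ _ _ uv _ ->|q /C2 //].
  rewrite /= in_itv /= => utv.
  exists (Num.max u (t - r / 2)), (Num.min v (t + r / 2)); split.
  - by rewrite le_max lexx orbT.
  - by rewrite ge_min lexx orbT.
  - rewrite gt_max !lt_min; clear C2; lra.
  - by move=> x; rewrite gt_max lt_min /= in_itv /= => /andP[/andP[-> _] /andP[->]].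
have [B Bbad] := preimages_of_partition n.
have [t' t'uv t'B] := itv_avoid B uv.
have Rt' : R0 b t' by exact: Rb.
have [s [x [Zs _ x0 xs]]] := cov t' (R_unit MF (R0_sub MF Rt')).
have xw := traj_ginv_word xs.
(* A symbol of class 1 or 2 would put [x i] in the partition, and hence [t'] in [B]. *)
have s0 i : (i < n)%N -> mm_class (s i) = class0.
  move=> ilt; have := graph_D MF (xs i).
  case: (D_shapeP MF (s i)) => // p _ pP -> _ /= xp.
  by move: t'B; rewrite -x0 (xw i) xp Bbad // size_mkseq.
have sC i : (i < n)%N -> C (s i).
  by move=> ilt; apply: (essential_class MF PF eC); rewrite s0.
(* By the empty word [B] contains the partition, so [t'] is interior to the cell of [s 0]. *)
have bs : transition b (s 0%N).
  apply: (D0_meet_R0 MF Rt'); have := graph_D MF (xs 0%N); rewrite x0.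
  case: (D_shapeP MF (s 0%N)) => [i _ iP _ -> ->|p]; last by rewrite s0.
  rewrite /= !in_itv /= !lt_neqAle => /andP[-> ->]; rewrite !andbT.
  have nP p : p \in mm_P F -> p != t'.
    by move=> pP; apply: contra t'B => /eqP <-; exact: (Bbad [::]).
  by rewrite nP ?mem_nth 1?eq_sym ?nP ?mem_nth // ltnW.
pose e q := if (q < n)%N then s (n - q.+1)%N else b.
have ep : bpath C e 0 n.
  split=> q qn; rewrite /e; first by case: ifP => // ?; apply: sC; lia.
  have -> : (q < n)%N by lia.
  case: ifP => qn'; last by have -> : (n - q.+1 = 0)%N by lia.
  have -> : (n - q.+1 = (n - q.+2).+1)%N by lia.
  exact: ZM.
exists e; split=> // [|y yc]; first by rewrite /e ltnn.
have wE : bword e n = mkseq s n.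
  rewrite -bword_rev; apply/eq_in_map => i; rewrite mem_iota add0n => /= ilt.
  by rewrite /e; have -> : (n - i.+1 < n)%N by lia.
have ep' : bpath C e 0 n0 by apply: bpath_sub ep; lia.
have Iy := Iword_bword ep' yc.
have It' : Iword (bword e n) t'.
  exists (x n); last by rewrite wE -xw.
  rewrite word_dom_bword /e /= subn1 /=; exact: (graph_R MF (xs n0)).
(* Both points lie in the short arc of the same word. *)
have : `|y n - t'| < r / 2.
  apply: le_lt_trans (len_ge (Iword_unit ep') Iy It') _.
  rewrite -/n wE; have -> : mkseq s n = [tuple s i | i < n].
    by rewrite /= /mkseq -val_enum_ord -map_comp.
  apply: small; exists s, 0%N; split=> //=.
  by rewrite /mkseq -val_enum_ord -map_comp.
rewrite !ltr_norml; clear -t'uv ut tv; lra.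
Qed.

(** A single code forces shadowing of [w] with a delay of [n] coordinates, the room taken by the
    continuation that pins down the last point. *)
Definition trackable C w m n r := exists e, bpath C e 0 (m + n) /\
  forall y, coded e 0 (m + n).+1 y ->
  forall k, (k <= m.+1)%N -> `|w k - y (k + n)%N| < r.

Lemma coding_track C z e m n r d : bpath C e 0 m -> coded e 0 m.+1 z ->
  (forall z', coded e 0 m.+1 z' -> `|z' 0%N - z 0%N| < d ->
     forall k, (k <= m.+1)%N -> `|z k - z' k| < r) ->
  (exists e', [/\ bpath C e' 0 n, e' n = e 0%N &
     forall y, coded e' 0 n y -> `|y n - z 0%N| < d]) ->
  trackable C z m n r.
Proof.
move=> ep zc zd [e' [e'p e'n e'd]].
exists (splice n e' (fun q => e (q - n)%N)); split.
  apply: bpath_splice => //; first by rewrite subnn.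
  by have := bpath_shift n ep.
move=> y yc k km; apply: (zd (fun q => y (q + n)%N)) => //.
  move=> q qm; have := yc (q + n)%N ltac:(by lia); rewrite /splice addSn.
  case: ifP => h; last by rewrite addnK.
  (* The seam: both codes carry the letter [e 0] at index [n]. *)
  have -> : q = 0%N by lia.
  by rewrite add0n e'n.
rewrite add0n; apply: e'd.
apply: (eq_coded (e := splice n e' (fun q => e (q - n)%N))).
  by move=> q qn; rewrite /splice ltnW.
by apply: coded_sub yc; lia.
Qed.

Lemma coded_continuous C e m z r : bpath C e 0 m -> coded e 0 m.+1 z -> 0 < r ->
  exists2 d, 0 < d & forall z', coded e 0 m.+1 z' -> `|z' 0%N - z 0%N| < d ->
    forall k, (k <= m.+1)%N -> `|z k - z' k| < r.
Proof.
move=> ep zc r0; have Rz := graph_R MF (zc 0%N (ltn0Sn _)).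
suff H i : (i <= m.+1)%N -> exists2 d, 0 < d & forall z', coded e 0 m.+1 z' ->
    `|z' 0%N - z 0%N| < d -> forall k, (k <= i)%N -> `|z k - z' k| < r.
  exact: H.
elim: i => [_|i IH im].
  by exists r => // z' _ ? k; rewrite leqn0 => /eqP ->; rewrite distrC.
have [d d0 H] := IH (ltnW im).
have [d' d'0 H'] := ginv_word_cont MF ep im Rz r0.
exists (Num.min d d'); first by rewrite lt_min d0.
move=> z' z'c; rewrite lt_min => /andP[zd zd'] k.
rewrite leq_eqVlt => /orP[/eqP ->|]; last exact: H.
rewrite (coded_ginv_word MF zc im) (coded_ginv_word MF z'c im).
by apply: H'; [exact: (graph_R MF (z'c 0%N _))|rewrite distrC].
Qed.

Lemma trackable_near C w z m n (r r' : R) :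
  (forall k, (k <= m.+1)%N -> `|w k - z k| < r) ->
  trackable C z m n r' -> trackable C w m n (r + r').
Proof.
move=> wz [e [ep H]]; exists e; split=> // y yc k km.
apply: le_lt_trans (ler_distD (z k) _ _) _.
by apply: ltrD; [exact: wz|exact: H].
Qed.

(** The delay [n] comes from continuity along one code, so it may depend on [w] and [m]; this
    suffices for statements about open sets. *)
Lemma trackable_pointwise C w m r : @essential_symbols R F `<=` C -> irreducible C ->
  coding_condition F -> back_traj F w -> 0 < r -> exists n, trackable C w m n r.
Proof.
move=> eC irr cc wY r0; have r2 : 0 < r / 2 by lra.
have wF k : (k < m.+1)%N -> graphF F (w k.+1, w k) by case: (wY k).
have [e [z [ep zc Rz wz]]] := essential_dense MF PF eC r2 wF.
have [d d0 zd] := coded_continuous ep zc r2.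
have [n ext] := coding_extension eC irr cc d0.
exists n.+1; rewrite [r]splitr; apply: (trackable_near wz).
by apply: (coding_track ep zc zd); apply: ext => //; exact: ep.1.
Qed.

(** Equicontinuity gives one [d] for all words of [C], so the delay [n] depends on neither [w] nor
    [m]. *)
Lemma trackable_uniform C r : @essential_symbols R F `<=` C -> irreducible C ->
  coding_condition F ->
  uniformly_equicontinuous (lang (SigmaM_in C)) (@word_dom R F) (@ginv_word R F) ->
  0 < r -> exists n, forall w m, back_traj F w -> trackable C w m n r.
Proof.
move=> eC irr cc eq r0; have r2 : 0 < r / 2 by lra.
have [d d0 gd] := eq _ r2.
(* The bound [r / 2] handles coordinate 0, where the word is empty. *)
have d'0 : 0 < Num.min d (r / 2) by rewrite lt_min d0.
have [n ext] := coding_extension eC irr cc d'0.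
exists n.+1 => w m wY.
have wF k : (k < m.+1)%N -> graphF F (w k.+1, w k) by case: (wY k).
have [e [z [ep zc Rz wz]]] := essential_dense MF PF eC r2 wF.
rewrite [r]splitr; apply: (trackable_near wz).
apply: (coding_track ep zc _ (ext _ _ (ep.1 0%N _) Rz)) => // z' z'c.
rewrite lt_min distrC => /andP[zd zr] [//|k] km.
rewrite (coded_ginv_word MF zc km) (coded_ginv_word MF z'c km).
apply: (gd _ _ _ _ _ _ zd); rewrite ?word_dom_bword.
- exists k.+1 => //; apply: lang_n_bword => [a|]; first exact: irreducible_succ.
  by apply: bpath_sub ep; lia.
- exact: (graph_R MF (zc 0%N _)).
- exact: (graph_R MF (z'c 0%N _)).
Qed.

End Tracking.

(** * Dynamics of the shift *)


Section Conclusion.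
Context {R : realType} (F : multimap_data R).
Hypothesis MF : is_markov_multimap F.
Hypothesis PF : properly_parametrized F.
Local Notation A := (mm_A F).
Local Notation S := (@shiftY R F).
Implicit Types (a b : A) (e : nat -> A) (i j k m n : nat) (C : set A) (w y z : backY F).

(** Otherwise some points outside [U] agree with [w] ever more closely on ever more coordinates, and
    so converge to [w] pointwise. *)
Lemma backY_cylinder (U : set (backY F)) w : open U -> U w ->
  exists m r, 0 < r /\ forall y : backY F,
    (forall k, (k <= m.+1)%N -> `|set_val w k - set_val y k| < r) -> U y.
Proof.
move=> -[V oV VU] Uw; apply: contrapT => no.
have [f fP] : {f : nat -> backY F & forall n,
    (forall k, (k <= n.+1)%N -> `|set_val w k - set_val (f n) k| < n.+1%:R^-1) /\ ~ U (f n)}.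
  apply: (@choice _ _ (fun n (y : backY F) =>
    (forall k, (k <= n.+1)%N -> `|set_val w k - set_val y k| < n.+1%:R^-1) /\ ~ U y)) => n.
  apply: contrapT => nn; apply: no; exists n, n.+1%:R^-1; split=> // y wy.
  by apply: contrapT => Uy; apply: nn; exists y.
have : {ptws, (fun n => set_val (f n) : nat -> R) @ \oo --> (set_val w : nat -> R)}.
  apply/pointwise_cvgP => k; apply/cvgrPdist_lt => r r0.
  have [N rN] := ltr_add_invr r0; rewrite add0r in rN.
  exists (maxn k N) => // n /=; rewrite geq_max => /andP[kn Nn].
  apply: (lt_trans ((fP n).1 k (leqW kn))); apply: le_lt_trans rN.
  by rewrite lef_pV2 ?posrE ?ltr0n // ler_nat.
have VV : nbhs (set_val w : {ptws nat -> R}) V.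
  by apply: open_nbhs_nbhs; split=> //; move: Uw; rewrite -VU.
move=> /(_ V VV) [N _ /(_ N (leqnn N)) VN].
by apply: (fP N).2; rewrite -VU.
Qed.

(** A link between the end letters turns the code into part of one period of a periodic code. *)
Lemma irreducible_close C e i j : irreducible C -> (i <= j)%N -> bpath C e i j ->
  exists y, (exists2 p, (0 < p)%N & forall k, set_val y (k + p)%N = set_val y k) /\
    coded e i j.+1 (set_val y).
Proof.
move=> irr ij ep.
have [e' [l [jl e'p e'j e'l]]] : exists e' l,
    [/\ (j < l)%N, bpath C e' j l, e' j = e j & e' l = e i].
  by apply: irreducible_link irr _ _; apply: ep.1; rewrite ?leqnn ?ij.
have := bpath_splice ij (esym e'j) ep e'p; set s := splice j e e' => sp.
have il : (i + (l - i) = l)%N by lia.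
have sil : s (i + (l - i))%N = s i.
  by rewrite il /s /splice ij; have -> : (l <= j)%N = false by lia.
rewrite -il in sp.
have li : (0 < l - i)%N by lia.
have [y [yp yc]] := periodic_bpath MF li sil sp.
exists y; split; first by exists (l - i)%N.
apply: (eq_coded (e := s)); last by apply: coded_sub yc; lia.
by move=> k kj; rewrite /s /splice; have -> : (k <= j)%N by lia.
Qed.

Lemma irreducible_dense_periodic C : @essential_symbols R F `<=` C ->
  irreducible C -> coding_condition F -> dense (periodic_points S).
Proof.
move=> eC irr cc U [w Uw] oU.
have [m [r [r0 Ur]]] := backY_cylinder oU Uw.
have [n [e [ep er]]] := trackable_pointwise MF PF m eC irr cc (set_valP w) r0.
have [y [[p p0 yp] yc]] := irreducible_close irr (leq0n _) ep.
(* The shift drops the [n] coordinates of the auxiliary continuation. *)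
exists (iter n S y); split.
  by apply: Ur => k km; rewrite iter_shiftY; exact: er.
exists p => //; apply: iter_shiftY_id => k.
by rewrite !iter_shiftY addnAC yp.
Qed.

(* Backward time: the block near [w1] has the smaller indices. *)
Lemma two_blocks C e e1 e2 i1 i2 j : irreducible C -> (i1 <= j)%N ->
  bpath C e1 0 i1 -> bpath C e i1 j -> bpath C e2 0 i2 ->
  e i1 = e1 i1 -> e j = e2 0%N -> exists y,
    coded e1 0 i1.+1 (set_val y) /\
    coded e2 0 i2.+1 (fun k => set_val y (k + j)%N).
Proof.
move=> irr ij p1 p p2 E1 E2.
have p2' := bpath_shift j p2; rewrite add0n in p2'.
have Ej : e j = (fun k => e2 (k - j)%N) j by rewrite E2 subnn.
have p12 := bpath_splice ij Ej p p2'.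
have Ei : e1 i1 = splice j e (fun k => e2 (k - j)%N) i1 by rewrite /splice ij.
have P := bpath_splice (leq0n _) Ei p1 p12.
have [y [_ yc]] := irreducible_close irr (leq0n _) P; exists y; split.
  apply: (eq_coded _ (coded_sub (i' := 0) (j' := i1.+1) _ _ yc)) => //; last by lia.
  by move=> k /=; rewrite ltnS /splice => ->.
move=> k ki; have := yc (k + j)%N; rewrite /splice addSn.
(* In the first two cases [k] is 0: the letter at [j] is stored by an earlier piece and equals
   [e2 0]. *)
case: ifP => h1; [move=> H|case: ifP => h2 H].
- have k0 : k = 0%N by lia.
  have ji : j = i1 by lia.
  move: H; rewrite k0 add0n -E2 ji E1; apply; lia.
- have k0 : k = 0%N by lia.
  by move: H; rewrite k0 add0n -E2; apply; lia.
- by move: H; rewrite addnK; apply; lia.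
Qed.

Lemma irreducible_transitive C : @essential_symbols R F `<=` C ->
  irreducible C -> coding_condition F -> topologically_transitive S.
Proof.
move=> eC irr cc U V oU oV [w1 Uw1] [w2 Vw2].
have [m1 [r1 [r10 U1]]] := backY_cylinder oU Uw1.
have [m2 [r2 [r20 V2]]] := backY_cylinder oV Vw2.
have [n1 [e1 [p1 er1]]] := trackable_pointwise MF PF m1 eC irr cc (set_valP w1) r10.
have [n2 [e2 [p2 er2]]] := trackable_pointwise MF PF m2 eC irr cc (set_valP w2) r20.
have [e [j [ij p E1 E2]]] : exists e j, [/\ (m1 + n1 < j)%N,
    bpath C e (m1 + n1) j, e (m1 + n1)%N = e1 (m1 + n1)%N & e j = e2 0%N].
  by apply: irreducible_link irr _ _; [apply: p1.1|apply: p2.1]; rewrite ?leqnn.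
have [y [y1 y2]] := two_blocks irr (ltnW ij) p1 p p2 E1 E2.
(* The orbit of [y] is near [w1] at time [n1] and near [w2] at time [j + n2]; [n1 < j] keeps the
   subtraction exact. *)
exists (j + n2 - n1)%N, (iter (j + n2 - n1) S (iter n1 S y)); split.
  exists (iter n1 S y) => //; apply: U1 => k km.
  by rewrite iter_shiftY; exact: er1.
apply: V2 => k km; rewrite !iter_shiftY.
have -> : (k + (j + n2 - n1) + n1 = k + n2 + j)%N by lia.
exact: (er2 (fun k => set_val y (k + j)%N)).
Qed.

Lemma mixing_topologically_mixing C : @essential_symbols R F `<=` C ->
  mixing C -> coding_condition F -> topologically_mixing S.
Proof.
move=> eC mix cc U V oU oV [w1 Uw1] [w2 Vw2].
have irr := mixing_irreducible mix; have [N link] := mixing_link mix.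
have [m1 [r1 [r10 U1]]] := backY_cylinder oU Uw1.
have [m2 [r2 [r20 V2]]] := backY_cylinder oV Vw2.
have [n1 [e1 [p1 er1]]] := trackable_pointwise MF PF m1 eC irr cc (set_valP w1) r10.
have [n2 [e2 [p2 er2]]] := trackable_pointwise MF PF m2 eC irr cc (set_valP w2) r20.
(* Here [j] solves [q = j + n2 - n1]; the threshold leaves the link length at least [N]. *)
exists (m1 + n1 + n2 + N)%N => q qN; set j := (q + n1 - n2)%N.
have ij : (m1 + n1 + N <= j)%N by lia.
have C1 : C (e1 (m1 + n1)%N) by apply: p1.1; rewrite /= leqnn.
have [e [p E1 E2]] := link _ _ _ _ C1 (p2.1 0%N isT) ij.
have [y [y1 y2]] := two_blocks irr (leq_trans (leq_addr _ _) ij) p1 p p2 E1 E2.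
exists (iter q S (iter n1 S y)); split.
  exists (iter n1 S y) => //; apply: U1 => k km.
  by rewrite iter_shiftY; exact: er1.
apply: V2 => k km; rewrite !iter_shiftY.
have -> : (k + q + n1 = k + n2 + j)%N by lia.
exact: (er2 (fun k => set_val y (k + j)%N)).
Qed.

(** Induction on the number of blocks, each gap of length at least [N] being filled by a link. *)
Lemma mixing_blocks C N (e : nat -> nat -> A) (s t : nat -> nat) l :
  (forall a b i j, C a -> C b -> (i + N <= j)%N ->
     exists e', [/\ bpath C e' i j, e' i = a & e' j = b]) ->
  (forall k, (k <= l)%N -> (s k <= t k)%N) ->
  (forall k, (k < l)%N -> (t k + N <= s k.+1)%N) ->
  (forall k, (k <= l)%N -> bpath C (e k) (s k) (t k)) ->
  exists e', bpath C e' (s 0%N) (t l) /\ forall k, (k <= l)%N ->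
    [/\ (s 0%N <= s k)%N, (t k <= t l)%N & forall q, (s k <= q <= t k)%N -> e' q = e k q].
Proof.
move=> link; elim: l => [|l IH] st ts ep.
  exists (e 0%N); split; first exact: ep.
  by move=> k; rewrite leqn0 => /eqP ->.
have [|||e1 [p1 E1]] := IH.
- by move=> k kl; apply: st; lia.
- by move=> k kl; apply: ts; lia.
- by move=> k kl; apply: ep; lia.
have tsl := ts l (ltnSn l); have stl := st l (leqnSn l); have stl1 := st l.+1 (leqnn _).
have [s0l _ El] := E1 l (leqnn l).
have pl := ep l.+1 (leqnn _).
have C1 : C (e1 (t l)) by apply: p1.1; lia.
have C2 : C (e l.+1 (s l.+1)) by apply: pl.1; lia.
have [e2 [p2 E2 E3]] := link _ _ _ _ C1 C2 tsl.
have ts' : (t l <= s l.+1)%N by lia.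
have s0t : (s 0%N <= t l)%N by lia.
have p3 := bpath_splice ts' E3 p2 pl.
have E4 : e1 (t l) = splice (s l.+1) e2 (e l.+1) (t l) by rewrite /splice ts' E2.
have P := bpath_splice s0t E4 p1 p3.
exists (splice (t l) e1 (splice (s l.+1) e2 (e l.+1))); split=> // k.
rewrite leq_eqVlt => /orP[/eqP ->|].
  split=> //; first by lia.
  move=> q qs; rewrite /splice; case: ifP => h1; last first.
    by case: ifP => // h2; have -> : q = s l.+1 by lia.
  have -> : q = s l.+1 by lia.
  have tE : t l = s l.+1 by lia.
  by rewrite -E3 -tE E2.
rewrite ltnS => kl; have [h1 h2 h3] := E1 k kl; split=> //; first by lia.
move=> q qk; rewrite /splice; have -> : (q <= t l)%N by lia.
exact: h3.
Qed.

(** Coordinates differ by at most 1, so from index [n] on the weight alone makes the terms small. *)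
Lemma Ydist_lt y z r n : 0 < r -> n.+1%:R^-1 < r / 2 ->
  (forall k, (k < n)%N -> `|set_val y k - set_val z k| < r / 2) -> Ydist y z < r.
Proof.
move=> r0 nr H; apply: (@le_lt_trans _ _ (r / 2)); last by lra.
apply: ge_sup; first by exists (`|set_val y 0%N - set_val z 0%N| / 1%:R), 0%N.
move=> _ [k _ <-].
have k1 : 0 < k.+1%:R :> R by rewrite ltr0n.
case: (ltnP k n) => kn.
  apply: le_trans (ltW (H k kn)); rewrite ler_pdivrMr // ler_peMr //.
  by rewrite ler1n.
apply: le_trans (ltW nr); apply: (@le_trans _ _ k.+1%:R^-1); last first.
  by rewrite lef_pV2 ?posrE ?ltr0n // ler_nat.
rewrite ler_pdivrMr // mulVf ?gt_eqF //.
have unit (u : backY F) : 0 <= set_val u k <= 1.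
  by have [] := set_valP u k; rewrite /unit_interval /= in_itv.
by have := unit y; have := unit z; rewrite ler_norml; lra.
Qed.

Lemma mixing_specification C : @essential_symbols R F `<=` C -> mixing C ->
  coding_condition F ->
  uniformly_equicontinuous (lang (SigmaM_in C)) (@word_dom R F) (@ginv_word R F) ->
  specification (@Ydist R F) S.
Proof.
move=> eC mix cc eq r r0.
have irr := mixing_irreducible mix; have [N link] := mixing_link mix.
have r2 : 0 < r / 2 by lra.
have [J rJ] := ltr_add_invr r2; rewrite add0r in rJ.
have [n track] := trackable_uniform MF PF eC irr cc eq r2.
(* [J] coordinates matter for the metric, [n] is the tracking delay and [N] the link length. The
   extra 1 makes the period end strictly after the last block. *)
exists (J + n + N).+1 => l x a b p ab ba bp.
(* Block [k] occupies these letters: the time interval, lengthened by the metric window and the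
   delay. *)
pose s k := a (inord k); pose t k := (b (inord k) + J + n)%N.
have trk (k : nat) : exists e, bpath C e (s k) (t k) /\ forall y : nat -> R,
    coded e (s k) (t k).+1 y -> forall i, (s k <= i <= b (inord k) + J.+1)%N ->
    `|set_val (x (inord k)) i - y (i + n)%N| < r / 2.
  have abk := ab (inord k).
  have [e [ep er]] := track (set_val (iter (s k) S (x (inord k))))
    (b (inord k) - s k + J)%N (set_valP _).
  have E : (b (inord k) - s k + J + n + s k = t k)%N by rewrite /s /t; lia.
  exists (fun q => e (q - s k)%N); split.
    by have := bpath_shift (s k) ep; rewrite add0n E.
  move=> v vc i ik; have := er (fun q => v (q + s k)%N).
  move=> /(_ _ (i - s k)%N) H; move: H; rewrite iter_shiftY subnK; last by lia.
  have -> : (i - s k + n + s k = i + n)%N by lia.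
  apply; last by lia.
  move=> q qk; have := vc (q + s k)%N; rewrite addnK addSn; apply; lia.
have [e eP] := choice trk.
have sE (k : 'I_l.+1) : s k = a k by rewrite /s inord_val.
have tE (k : 'I_l.+1) : t k = (b k + J + n)%N by rewrite /t inord_val.
have [|||e' [e'p e'E]] := @mixing_blocks C N e s t l link.
- by move=> k kl; have := ab (inord k); rewrite /s /t; lia.
- move=> k kl; have := ba (inord k) (inord k.+1).
  by rewrite /s /t !inordK => [/(_ erefl)| |]; lia.
- by move=> k kl; exact: (eP k).1.
have tl : t l = (b ord_max + J + n)%N by rewrite -[l in t l]/(val (@ord_max l)) tE.
have [s0l _ _] := e'E l (leqnn l).
have stl : (s l <= t l)%N by have := ab (inord l); rewrite /s /t; lia.
have C1 : C (e' (t l)) by apply: e'p.1; lia.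
have C2 : C (e' (s 0%N)) by apply: e'p.1; lia.
have tsp : (t l + N <= s 0%N + p)%N by lia.
(* The last link joins the end of the last block to a copy of the first letter [p] places after
   it. *)
have [e2 [p2 E2 E3]] := link _ _ _ _ C1 C2 tsp.
have slt : (s 0%N + p <= t l)%N = false by lia.
have [s0p p0] : (s 0%N <= t l)%N /\ (0 < p)%N by split; lia.
have P := bpath_splice s0p (esym E2) e'p p2.
have cyc : splice (t l) e' e2 (s 0%N + p)%N = splice (t l) e' e2 (s 0%N).
  by rewrite /splice slt E3 s0p.
have [y [yp yc]] := periodic_bpath MF p0 cyc P.
exists (iter n S y).
  by apply: iter_shiftY_id => k; rewrite !iter_shiftY addnAC yp.
(* For [j < J] the coordinate [i + j] is at most [b k + J], within the tracked range of block
   [k]. *)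
move=> k i ik; apply: (Ydist_lt (n := J)) => // j jJ.
have [h1 h2 h3] := e'E k (ltn_ord k).
have := (eP k).2 (set_val y); rewrite inord_val => H.
rewrite !iter_shiftY distrC; apply: H; last by rewrite sE; lia.
apply: (eq_coded _ (coded_sub (i' := s k) (j' := (t k).+1) _ _ yc)) => //; last by lia.
move=> q qk; rewrite /splice; have -> : (q <= t l)%N by lia.
exact: h3.
Qed.

End Conclusion.

Theorem corollary7p8 (R : realType) (F : multimap_data R)
    (F_markov : is_markov_multimap F) (F_proper : properly_parametrized F) :
  [/\ irreducibility_condition F -> coding_condition F ->
        devaney_chaotic (@shiftY R F),
      mixing_condition F -> coding_condition F ->
        topologically_mixing (@shiftY R F) &
      forall C0 : set (mm_A F),
        mixing_component C0 -> @essential_symbols R F `<=` C0 ->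
        coding_condition F ->
        uniformly_equicontinuous (lang (SigmaM_in C0))
          (@word_dom R F) (@ginv_word R F) ->
        specification (@Ydist R F) (@shiftY R F)].
Proof.
split.
- move=> [C [irr _] eC] cc; split.
    exact: irreducible_transitive eC irr cc.
  exact: irreducible_dense_periodic eC irr cc.
- by move=> [C [mix _] eC] cc; exact: (mixing_topologically_mixing _ _ eC mix cc).
- by move=> C0 [mix _] eC cc eq; exact: (mixing_specification _ _ eC mix cc eq).
Qed.
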